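(* The following problem is undecidable: given two labelled MDPs $\mathcal{D}_1,\mathcal{D}_2$ over the same finite label set (with rational probabilities), decide whether both $\mathcal{D}_1\sqsubseteq\mathcal{D}_2$ and $\mathcal{D}_2\sqsubseteq\mathcal{D}_1$ hold.
   Context: A labelled Markov decision process (MDP) is a tuple $\mathcal{D}=\langle Q,\mu_0,L,\delta\rangle$ where $Q$ is a finite set of states, $\mu_0$ a probability distribution on $Q$, $L$ a finite set of labels, and $\delta$ assigns to each state $q$ a finite nonempty set $\mathsf{moves}(q)$ of moves, each a probability distribution over $L\times Q$ (written $\mathsf{m}(a,q')$). A path is $\rho=q_0a_1q_1\cdots a_nq_n$, with trace $a_1\cdots a_n$ and last state $q_n$. A strategy $\alpha$ maps each path $\rho$ to a distribution on $\mathsf{moves}(\mathsf{last}(\rho))$. Path probabilities: $\Pr_{\mathcal{D},\alpha}(q_0)=\mu_0(q_0)$, $\Pr_{\mathcal{D},\alpha}(\rho a q)=\Pr_{\mathcal{D},\alpha}(\rho)\sum_{\mathsf{m}}\alpha(\rho)(\mathsf{m})\mathsf{m}(a,q)$. The trace-probability function is $\mathit{Tr}_{\mathcal{D},\alpha}(w)=\sum_{\text{trace}(\rho)=w}\Pr_{\mathcal{D},\alpha}(\rho)$ for $w\in L^*$. $\mathcal{D}\sqsubseteq\mathcal{E}$ means: for every strategy $\alpha$ of $\mathcal{D}$ there is a strategy $\beta$ of $\mathcal{E}$ with $\mathit{Tr}_{\mathcal{D},\alpha}=\mathit{Tr}_{\mathcal{E},\beta}$. *)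

(* Defs.v *)
From HB Require Import structures.
From mathcomp Require Import all_boot all_order all_algebra.
From mathcomp Require Import reals.

Set Implicit Arguments.
Unset Strict Implicit.
Unset Printing Implicit Defensive.

Import Order.TTheory GRing.Theory Num.Theory.
Local Open Scope ring_scope.

(** * Labelled Markov decision processes *)

Definition is_dist (T : finType) (d : {ffun T -> rat}) : bool :=
  [forall x, 0 <= d x] && (\sum_x d x == 1).

(* The finite nonempty set of moves of a state is given by a duplicate-free
   nonempty list; a move is a distribution on L * Q. *)
Record mdp (L Q : finType) := MDP {
  init : {ffun Q -> rat};
  moves : Q -> seq {ffun L * Q -> rat};
  init_dist : is_dist init;
  moves_dist : forall q m, m \in moves q -> is_dist m;
  moves_uniq : forall q, uniq (moves q);
  moves_neq0 : forall q, moves q != [::]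
}.

Section Semantics.
Variables (L Q : finType).

(* (q0, [:: (a1, q1); ...; (an, qn)]) is the path q0 a1 q1 ... an qn. *)
Definition lpath : Type := (Q * seq (L * Q))%type.

Definition last_state (rho : lpath) : Q := last rho.1 (unzip2 rho.2).

Definition trace (rho : lpath) : seq L := unzip1 rho.2.

Variables (R : realType) (D : mdp L Q).

(* Only the values alpha rho m with m a move of the last state of rho are
   relevant. *)
Definition is_strategy (alpha : lpath -> {ffun L * Q -> rat} -> R) : Prop :=
  forall rho,
    (forall m, m \in moves D (last_state rho) -> 0 <= alpha rho m) /\
    \sum_(m <- moves D (last_state rho)) alpha rho m = 1.

Variable alpha : lpath -> {ffun L * Q -> rat} -> R.

(* The recursion extends a path at its end, hence the steps s of the path are
   stored in reverse; see path_prob0 and path_prob_rcons. *)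
Fixpoint path_prob_rev (q0 : Q) (s : seq (L * Q)) : R :=
  if s is x :: s' then
    let rho := (q0, rev s') in
    path_prob_rev q0 s' *
      \sum_(m <- moves D (last_state rho)) alpha rho m * ratr (m x)
  else ratr (init D q0).

Definition path_prob (rho : lpath) : R := path_prob_rev rho.1 (rev rho.2).

Lemma path_prob0 q0 : path_prob (q0, [::]) = ratr (init D q0).
Proof. by []. Qed.

Lemma path_prob_rcons q0 s a q :
  path_prob (q0, rcons s (a, q)) =
  path_prob (q0, s) *
    \sum_(m <- moves D (last_state (q0, s))) alpha (q0, s) m * ratr (m (a, q)).
Proof. by rewrite /path_prob /= rev_rcons /= revK. Qed.

(* A path with trace w has exactly size w steps. *)
Definition Tr (w : seq L) : R :=
  \sum_(rho : Q * (size w).-tuple (L * Q) | trace (rho.1, val rho.2) == w)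
     path_prob (rho.1, val rho.2).

End Semantics.

Definition refines (R : realType) (L Q1 Q2 : finType)
    (D : mdp L Q1) (E : mdp L Q2) : Prop :=
  forall alpha : lpath L Q1 -> {ffun L * Q1 -> rat} -> R, is_strategy D alpha ->
  exists2 beta : lpath L Q2 -> {ffun L * Q2 -> rat} -> R,
    is_strategy E beta & Tr D alpha =1 Tr E beta.

(** * Partial recursive functions *)

(* Arities are not recorded in the syntax: Zero is the constant 0 of every arity,
   and an application that does not fit the clauses of eval is undefined. *)
Inductive recf : Type :=
| Zero
| Succ
| Proj of nat
| Comp of recf & seq recf
| Prec of recf & recf
| Mu of recf.

(* eval f xs y: the partial recursive function f is defined at the argument
   list xs, with value y.  In eval_mu, (g i).+1 is the nonzero value at i. *)
Inductive eval : recf -> seq nat -> nat -> Prop :=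
| eval_zero xs : eval Zero xs 0%N
| eval_succ x : eval Succ [:: x] x.+1
| eval_proj i xs : (i < size xs)%N -> eval (Proj i) xs (nth 0%N xs i)
| eval_comp f gs xs ys y :
    size ys = size gs ->
    (forall i, (i < size gs)%N -> eval (nth Zero gs i) xs (nth 0%N ys i)) ->
    eval f ys y -> eval (Comp f gs) xs y
| eval_prec0 f g xs y : eval f xs y -> eval (Prec f g) (0%N :: xs) y
| eval_precS f g n xs z y :
    eval (Prec f g) (n :: xs) z -> eval g [:: n, z & xs] y ->
    eval (Prec f g) (n.+1 :: xs) y
| eval_mu f (g : nat -> nat) xs n :
    (forall i, (i < n)%N -> eval f (i :: xs) (g i).+1) ->
    eval f (n :: xs) 0%N -> eval (Mu f) xs n.

Lemma eval_fun f xs y z : eval f xs y -> eval f xs z -> y = z.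
Proof.
move=> fy; elim: fy z => {f xs y}
  [xs|x|i xs ltix|f gs xs ys y szy _ IHg _ IHf|f g xs y _ IH
  |f g n xs u y _ IHu _ IHy|f g xs n _ IHg _ IH0] z fz;
  inversion fz as [| | |? ? ? ys' ? szy' Hg' Hf'|
    |? ? ? ? u' ? Hu' Hy'|? g' ? ? Hg' H0']; subst => //.
- apply: IHf; suff -> : ys = ys' by [].
  apply: (@eq_from_nth _ 0%N); first by rewrite szy szy'.
  by move=> i; rewrite szy => lti; apply: IHg => //; apply: Hg'.
- exact: IH.
- by apply: IHy; rewrite (IHu _ Hu').
- case: (ltngtP n z) => // lt.
  + by have := IH0 _ (Hg' _ lt).
  + by have := IHg _ lt _ H0'.
Qed.

(** * Decision problems on pairs of rational MDPs *)

Definition code_rat (x : rat) : nat :=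
  CodeSeq.code [:: absz (numq x); absz (denq x)].

(* The states and labels of D are numbered by enum; CodeSeq.code is a bijection
   from seq nat to nat.  The code lists the numbers of states and of labels, the
   initial distribution and, for each state, the tables of its moves.
   Probabilities are nonnegative, so code_rat needs no sign. *)
Definition code_mdp (L Q : finType) (D : mdp L Q) : nat :=
  CodeSeq.code [:: #|Q|; #|L|;
    CodeSeq.code [seq code_rat (init D q) | q <- enum Q];
    CodeSeq.code [seq CodeSeq.code [seq
        CodeSeq.code [seq code_rat (m (a, q')) | a <- enum L, q' <- enum Q]
      | m : {ffun L * Q -> rat} <- moves D q] | q <- enum Q]].

Definition mdp_problem : Type :=
  forall L Q1 Q2 : finType, mdp L Q1 -> mdp L Q2 -> Prop.

Definition decides (f : recf) (P : mdp_problem) : Prop :=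
  forall (L Q1 Q2 : finType) (D1 : mdp L Q1) (D2 : mdp L Q2),
    (P L Q1 Q2 D1 D2 -> eval f [:: code_mdp D1; code_mdp D2] 1%N) /\
    (~ P L Q1 Q2 D1 D2 -> eval f [:: code_mdp D1; code_mdp D2] 0%N).

Definition undecidable (P : mdp_problem) : Prop :=
  ~ exists f : recf, decides f P.

(* Main.v *)
Require Import Defs.
From mathcomp Require Import all_boot all_order all_algebra.
From mathcomp Require Import reals.
From mathcomp Require Import zify ring lra.

Set Implicit Arguments.
Unset Strict Implicit.
Unset Printing Implicit Defensive.

(* Equivalence of MDPs is related to halting as follows.  A partial recursive
   function is compiled to a finite graph whose edges carry affine assignments and
   affine tests on registers, guessing being allowed.  Along a word of edges, the
   sum of the squares of the failed tests is linear in the tensor square of the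
   configuration, hence is computed by an integer weighted automaton; ending the
   word with a letter that subtracts 1, the automaton takes a negative value iff
   the function halts.

   The automaton is simulated by a Markov chain that emits uniform letters and
   keeps the positive and the negative parts P(w) and N(w) of the value in two
   states.  When the word is ended, only the P-state may choose the last letter,
   so the probability of w followed by # ranges over [0, P(w)] (up to a factor).
   A second MDP may moreover exchange the two signs by its first move; the two
   MDPs are equivalent iff N(w) <= P(w) for all w.

   The input c of the program only occurs in the probabilities of the first
   moves, so that the codes of the two MDPs are simple functions of c and of a
   tuple of constants xs that depends on the program.  Given a decision procedure
   f, take the program which guesses xs with code xs = c and halts iff f answers
   yes on the two MDPs of constants xs: for its own constants xs, the MDPs are
   equivalent iff f answers no.  No universal function is needed. *)

(** * Programs with guessing, and their flow graphs *)

Definition store := nat -> nat.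
Definition upd (s : store) r v : store := fun x => if x == r then v else s x.

(* An atom (b, r, t, d) is the assignment r := t + d when b, and the test
   r = t + d otherwise. *)
Definition atom : Type := (bool * nat * nat * nat)%type.
Definition asg r t d : atom := (true, r, t, d).
Definition tst r t d : atom := (false, r, t, d).

Definition act (x : atom) (s : store) : store :=
  let: (b, r, t, d) := x in if b then upd s r (s t + d) else s.
Definition enabled (x : atom) (s : store) : bool :=
  let: (b, r, t, d) := x in b || (s r == s t + d).

Inductive prog := Atom of atom | Seq of prog & prog | Star of prog.

Inductive run : prog -> store -> store -> Prop :=
| run_atom x s : enabled x s -> run (Atom x) s (act x s)
| run_seq p q s t u : run p s t -> run q t u -> run (Seq p q) s u
| run_star0 p s : run (Star p) s s
| run_starS p s t u : run p s t -> run (Star p) t u -> run (Star p) s u.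

Lemma run_atomE x s s' : run (Atom x) s s' -> enabled x s /\ s' = act x s.
Proof. by move=> h; inversion h. Qed.

Lemma run_seqE p q s u : run (Seq p q) s u -> exists2 t, run p s t & run q t u.
Proof. by move=> h; inversion h; subst; exists t. Qed.

(** Plain induction on [run] would lose the fact that the program is [Star p]; it is kept as an
    equation. *)
Lemma run_star_ind p (P : store -> store -> Prop) :
  (forall s, P s s) -> (forall s t u, run p s t -> P t u -> P s u) ->
  forall s u, run (Star p) s u -> P s u.
Proof.
move=> P0 PS s u h; move: {-2}(Star p) h (erefl (Star p)) => q h.
elim: h => // {q s u} q s t u h1 _ _ ih [eq].
by subst q; apply: PS h1 (ih _).
Qed.

Definition edge : Type := (nat * atom * nat)%type.

Inductive flat (E : seq edge) : nat -> store -> nat -> store -> Prop :=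
| flat0 p s : flat E p s p s
| flatS p x q s r s' : (p, x, q) \in E -> enabled x s ->
    flat E q (act x s) r s' -> flat E p s r s'.

Lemma flat_trans E p s q t r u :
  flat E p s q t -> flat E q t r u -> flat E p s r u.
Proof. by elim=> // {p s q t} p x q s r' s' pE xs _ ih /ih; apply: flatS pE xs. Qed.

Lemma flat_sub (E E' : seq edge) p s q t :
  {subset E <= E'} -> flat E p s q t -> flat E' p s q t.
Proof.
move=> sub; elim=> {p s q t} [p s|p x q s r s' pE xs _]; first exact: flat0.
exact: flatS (sub _ pE) xs.
Qed.

Definition skip : atom := tst 0 0 0.

Lemma skip_on s : enabled skip s.
Proof. by rewrite /= addn0. Qed.

Fixpoint width (p : prog) : nat :=
  match p with
  | Atom _ => 1
  | Seq p q => width p + width q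
  | Star p => (width p).+2
  end.

(** The entry of [p] is [a], its exit is [a + width p]. A loop has entry and exit points distinct
    from those of its body, so that no edge of a program leaves its exit, which can then serve as
    the entry of the next program. *)
Fixpoint edges (p : prog) (a : nat) : seq edge :=
  match p with
  | Atom x => [:: (a, x, a.+1)]
  | Seq p q => edges p a ++ edges q (a + width p)
  | Star p => [:: (a, skip, a.+1); (a.+1 + width p, skip, a);
                  (a, skip, a + (width p).+2)] ++ edges p a.+1
  end.

Lemma edges_range p a i x j : (i, x, j) \in edges p a ->
  (a <= i < a + width p) && (a <= j <= a + width p).
Proof.
elim: p a => [y|p IHp q IHq|p IHp] a /=.
- by rewrite inE => /eqP[-> _ ->]; lia.
- by rewrite mem_cat => /orP[/IHp|/IHq]; lia.
- rewrite !inE => /or4P[/eqP[-> _ ->]|/eqP[-> _ ->]|/eqP[-> _ ->]|/IHp]; lia.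
Qed.

Lemma width_gt0 p : 0 < width p.
Proof. by elim: p => //= p; lia. Qed.

Lemma flat_complete p s s' a : run p s s' ->
  flat (edges p a) a s (a + width p) s'.
Proof.
move=> h; elim: h a => {p s s'} [x s xs|p q s t u _ ihp _ ihq|p s|p s t u _ ihp _ ihq] a /=.
- by rewrite addn1; apply: flatS (flat0 _ _ _) => //; rewrite inE.
- rewrite addnA; apply: (@flat_trans _ _ _ (a + width p) t).
    by apply: flat_sub (ihp a) => e; rewrite mem_cat => ->.
  by apply: flat_sub (ihq _) => e; rewrite mem_cat orbC => ->.
- by apply: (@flatS _ _ skip (a + (width p).+2)) (flat0 _ _ _); rewrite ?skip_on // !inE eqxx !orbT.
- apply: (@flatS _ _ skip a.+1); rewrite ?skip_on // ?inE ?eqxx //.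
  apply: (@flat_trans _ _ _ (a.+1 + width p) t).
    by apply: flat_sub (ihp a.+1) => e; rewrite !inE => ->; rewrite !orbT.
  by apply: (@flatS _ _ skip a) (ihq a); rewrite ?skip_on //= !inE eqxx !orbT.
Qed.

(** A path that has reached [b] can only use edges of [E2], since those of [E1] start below [b]; it
    is cut at its first visit to [b]. *)
Lemma flat_split E1 E2 b p s q s' :
  (forall i x j, (i, x, j) \in E1 -> (i < b) && (j <= b)) ->
  (forall i x j, (i, x, j) \in E2 -> (b <= i) && (b <= j)) ->
  p <= b -> b <= q -> flat (E1 ++ E2) p s q s' ->
  exists2 t, flat E1 p s b t & flat E2 b t q s'.
Proof.
move=> h1 h2 pb bq fl.
have stay i t j t' : flat (E1 ++ E2) i t j t' -> b <= i -> flat E2 i t j t'.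
  elim=> {i t j t'} [i t|i x k t j t' ixk xt _ ih] bi; first exact: flat0.
  move: ixk; rewrite mem_cat => /orP[/h1|ixk]; first by lia.
  have bk := h2 _ _ _ ixk.
  by apply: flatS ixk xt (ih _); lia.
elim: fl pb bq => {p s q s'} [p s|p x q s r s' pxq xs fl ih] pb br.
  by have -> : p = b by [lia]; exists s; exact: flat0.
move: (pxq); rewrite mem_cat => /orP[e|/h2/andP[bp bq]].
  have [t f1 f2] := ih (proj2 (andP (h1 _ _ _ e))) br.
  by exists t => //; apply: flatS e xs f1.
have e : p = b by lia.
exists s; first by rewrite e; exact: flat0.
by rewrite -{1}e; apply: stay; [apply: flatS pxq xs fl | rewrite e].
Qed.

Lemma flat_sound p s s' a : flat (edges p a) a s (a + width p) s' -> run p s s'.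
Proof.
elim: p a s s' => [x|p ihp q ihq|p ihp] a s s' /=.
- move=> fl; inversion fl as [? ? e|? ? ? ? ? ? e xs fl']; subst; first by lia.
  move: e; rewrite inE => /eqP[ex eq]; subst.
  inversion fl' as [|? ? ? ? ? ? e]; subst; first exact: run_atom.
  by move: e; rewrite inE => /eqP[]; lia.
- move=> /flat_split -/(_ (a + width p)) [i x j /edges_range|i x j /edges_range| | |t f1 f2]; try lia.
  by apply: (run_seq (ihp _ _ _ f1) (ihq (a + width p) _ _ _)); rewrite -addnA.
- set E := (X in flat X); set b := a.+1 + width p; set c := a + _.
  (* From the loop entry, the rest of the path is a run of the loop; from a point of the body, it
     completes the body and then runs the loop; from the exit, nothing remains. *)
  have gen i t j t' : flat E i t j t' -> j = c ->
      [/\ i = a -> run (Star p) t t',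
        a < i <= b -> exists2 u, flat (edges p a.+1) i t b u & run (Star p) u t'
      & i = c -> t = t'].
    elim=> {i t j t'} [i t ic|i x j t k t' ixj xt _ ih kc].
      have := width_gt0 p; split; rewrite ?ic // /c /b; lia.
    have [iha ihb ihc] := ih kc; have wp := width_gt0 p.
    move: ixj; rewrite !inE.
    case/or4P=> [/eqP[ei ex ej]|/eqP[ei ex ej]|/eqP[ei ex ej]|e]; subst.
    + split=> [_||]; rewrite /c; try lia.
      have [|u f1 f2] := ihb; first by rewrite /b; lia.
      by apply: run_starS f2; apply: (ihp a.+1).
    + split=> [|_|]; rewrite /b /c; try lia.
      by exists t; [exact: flat0|exact: iha].
    + split=> [_||]; rewrite /b /c; try lia.
      by rewrite -(ihc erefl); apply: run_star0.
    + have r := edges_range e; split; [lia| |rewrite /c; lia].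
      move=> ib; have [|u f1 f2] := ihb; first by rewrite /b; lia.
      by exists u => //; apply: flatS e xt f1.
  by move=> /gen/(_ erefl)[h _ _]; apply: h.
Qed.

(** * Compilation of recursive functions *)

(** [recf] is nested in [seq]: the explicit fixpoint provides induction hypotheses for the members
    of the list in [Comp]. *)
Lemma recf_nested_ind (P : recf -> Prop) :
  P Zero -> P Succ -> (forall i, P (Proj i)) ->
  (forall f gs, P f -> (forall i, i < size gs -> P (nth Zero gs i)) ->
     P (Comp f gs)) ->
  (forall f g, P f -> P g -> P (Prec f g)) -> (forall f, P f -> P (Mu f)) ->
  forall f, P f.
Proof.
move=> hZ hS hP hC hR hM; fix ih 1; case=> [||i|f gs|f g|f].
- exact: hZ.
- exact: hS.
- exact: hP.
- apply: hC; first exact: ih.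
  elim: gs => [|g gs ihgs] [|i] lti; [discriminate lti | discriminate lti | |].
    exact: ih.
  exact: ihgs.
- exact: hR.
- exact: hM.
Qed.

Notation "p ;; q" := (Seq p q) (at level 61, right associativity).

(* Register 0 always contains 0. *)
Definition set_const r d : prog := Atom (asg r 0 d).
Definition abort : prog := Atom (tst 0 0 1).
Definition guess r : prog := set_const r 0 ;; Star (Atom (asg r r 1)).

(* compile f args out lim stores in register out the value of f on the contents
   of the registers args, and uses the registers from lim on as scratch space. *)
Fixpoint compile (f : recf) (args : seq nat) (out lim : nat) : prog :=
  match f with
  | Zero => set_const out 0
  | Succ => if args is [:: a] then Atom (asg out a 1) else abort
  | Proj i => if i < size args then Atom (asg out (nth 0 args i) 0) else abort
  | Comp f gs =>
      let lim' := lim + size gs in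
      (fix compile_list (gs : seq recf) (j : nat) : prog :=
         if gs is g :: gs then compile g args j lim' ;; compile_list gs j.+1
         else compile f (iota lim (j - lim)) out lim') gs lim
  | Prec f g =>
      if args is n :: xs then
        let: (i, acc, tmp, lim') := (lim, lim.+1, lim.+2, lim.+3) in
        set_const i 0 ;; compile f xs acc lim' ;;
        Star (compile g [:: i, acc & xs] tmp lim' ;;
              Atom (asg acc tmp 0) ;; Atom (asg i i 1)) ;;
        Atom (tst i n 0) ;; Atom (asg out acc 0)
      else abort
  | Mu f =>
      let: (i, v, t, lim') := (lim, lim.+1, lim.+2, lim.+3) in
      set_const i 0 ;;
      Star (compile f (i :: args) v lim' ;; guess t ;; Atom (tst v t 1) ;;
            Atom (asg i i 1)) ;;
      compile f (i :: args) v lim' ;; Atom (tst v 0 0) ;; Atom (asg out i 0)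
  end.

Definition agree lim out (s s' : store) : Prop :=
  forall r, r < lim -> r != out -> s' r = s r.

Definition scoped (args : seq nat) out lim : bool :=
  [&& all (fun a => (a < lim) && (a != out)) args, 0 < out & out < lim].

(** Wrong guesses block a program, so correctness has two halves: every completed run returns a
    value of [f] and preserves the registers below [lim] other than [out]; every value of [f] is
    returned by some run. *)
Definition compiled f : Prop := forall args out lim, scoped args out lim ->
  (forall s s', run (compile f args out lim) s s' -> s 0 = 0 ->
     eval f (map s args) (s' out) /\ agree lim out s s') /\
  (forall s y, s 0 = 0 -> eval f (map s args) y ->
     exists2 s', run (compile f args out lim) s s' & s' out = y).

Lemma run_abort s s' : s 0 = 0 -> ~ run abort s s'.
Proof. by move=> s0 /run_atomE[] /=; rewrite s0. Qed.

Lemma compiled_zero : compiled Zero.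
Proof.
move=> args out lim sc; split=> [s s' /run_atomE[_ ->] s0|s y s0 ev] /=.
  rewrite /upd eqxx s0; split; first exact: eval_zero.
  by move=> r _ /negPf /= ->.
exists (upd s out 0); last by inversion ev; rewrite /upd eqxx.
by have := @run_atom (asg out 0 0) s isT; rewrite /= s0.
Qed.

Lemma compiled_succ : compiled Succ.
Proof.
move=> [|a [|b args]] out lim sc; split=> [s s'|s y s0 ev] /=;
  try solve [inversion ev].
- by move=> r s0; case: (run_abort s0 r).
- move=> /run_atomE[_ ->] s0 /=; rewrite /upd eqxx addn1.
  by split=> [|r _ /negPf ->] //; exact: eval_succ.
- exists (upd s out (s a).+1); last by inversion ev; rewrite /upd eqxx.
  by have := @run_atom (asg out a 1) s isT; rewrite /= addn1.
- by move=> r s0; case: (run_abort s0 r).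
Qed.

Lemma compiled_proj i : compiled (Proj i).
Proof.
move=> args out lim sc; split=> [s s'|s y s0 ev] /=; case: ifP => lti.
- move=> /run_atomE[_ ->] s0 /=; rewrite /upd eqxx addn0.
  split=> [|r _ /negPf ->] //; rewrite -(nth_map _ 0) //.
  by apply: eval_proj; rewrite size_map.
- by move=> r s0; case: (run_abort s0 r).
- exists (upd s out (s (nth 0 args i))).
    by have := @run_atom (asg out (nth 0 args i) 0) s isT; rewrite /= addn0.
  by inversion ev; rewrite /upd eqxx (nth_map 0).
- by inversion ev as [| |? ? lt|? ? ? ? ? ? ? ?| | |]; subst; rewrite size_map lti in lt.
Qed.

Lemma agreeW lim lim' out s t : lim <= lim' -> agree lim' out s t ->
  agree lim out s t.
Proof. by move=> le h r rl; apply: h; lia. Qed.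

Lemma agree_fresh lim lim' j s t r :
  agree lim' j s t -> lim <= j -> lim <= lim' -> r < lim -> t r = s r.
Proof. by move=> h lj ll rl; apply: h; lia. Qed.

Lemma map_below lim (s t : store) args :
  all (ltn^~ lim) args -> (forall r, r < lim -> t r = s r) ->
  map t args = map s args.
Proof. by move=> /allP lt h; apply/eq_in_map => a /lt /h. Qed.

Lemma scoped_lt args out lim : scoped args out lim -> all (ltn^~ lim) args.
Proof. by case/andP=> h _; apply: sub_all h => a /andP[]. Qed.

Lemma scoped_fresh args lim lim' j :
  all (ltn^~ lim) args -> 0 < lim -> lim <= j < lim' -> scoped args j lim'.
Proof.
move=> h lp jl; apply/and3P; split; try lia.
by apply: sub_all h => a /= al; lia.
Qed.

Lemma compiled_comp f gs : compiled f ->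
  (forall i, i < size gs -> compiled (nth Zero gs i)) -> compiled (Comp f gs).
Proof.
move=> hf hgs args out lim sc; rewrite /=.
set lim' := lim + size gs; set cl := (X in run (X gs lim)).
have ltargs := scoped_lt sc; have /and3P[_ op ol] := sc.
have hg pre g hs : gs = pre ++ g :: hs -> compiled g.
  move=> e; have := hgs (size pre); rewrite e size_cat nth_cat ltnn subnn /=.
  by apply; lia.
have scf : scoped (iota lim (size gs)) out lim'.
  apply/and3P; split=> //; last by rewrite /lim'; lia.
  by apply/allP => a; rewrite mem_iota /lim'; lia.
have scg pre g hs : gs = pre ++ g :: hs -> scoped args (lim + size pre) lim'.
  move=> e; apply: scoped_fresh ltargs _ _; first by lia.
  by rewrite /lim' e size_cat /=; lia.
split.
(* [pre] is the part of the list whose values are already in the registers from [lim] on, [hs] the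
   part still to be computed. *)
- have snd hs : forall pre s s', gs = pre ++ hs -> s 0 = 0 ->
      run (cl hs (lim + size pre)) s s' ->
      (forall i, i < size pre -> eval (nth Zero gs i) (map s args) (s (lim + i))) ->
      eval (Comp f gs) (map s args) (s' out) /\ agree lim out s s'.
    elim: hs => [|h hs ih] pre s s' e s0 /=.
      rewrite cats0 in e; rewrite -e addKn => r ev.
      have [evf ag] := (hf _ _ _ scf).1 _ _ r s0; split.
        apply: eval_comp evf; first by rewrite size_map size_iota.
        by move=> i lti; rewrite (nth_map 0) ?size_iota // nth_iota //; apply: ev.
      by apply: agreeW ag; rewrite /lim'; lia.
    move=> /run_seqE[t r1 r2] ev.
    have [evh ag] := (hg _ _ _ e _ _ _ (scg _ _ _ e)).1 _ _ r1 s0.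
    have st r : r < lim -> t r = s r.
      by apply: (agree_fresh ag); rewrite /lim'; lia.
    have em := map_below ltargs st.
    have e' : gs = rcons pre h ++ hs by rewrite cat_rcons.
    have [||i|evt agt] := ih (rcons pre h) t s' e'.
    + by rewrite st //; lia.
    + by rewrite size_rcons addnS.
    + rewrite size_rcons ltnS leq_eqVlt em => /orP[/eqP->|lti].
        by rewrite {1}e nth_cat ltnn subnn.
      have -> : t (lim + i) = s (lim + i); last exact: ev.
      by apply: ag; rewrite /lim' ?e ?size_cat /=; lia.
    + rewrite em in evt; split=> // r rl ro.
      by rewrite agt // st.
  move=> s s' r s0; apply: (snd gs [::]) => //=.
  by rewrite addn0.
- have cpl hs : forall pre s ys y, gs = pre ++ hs -> s 0 = 0 -> size ys = size gs ->
      (forall i, i < size gs -> eval (nth Zero gs i) (map s args) (nth 0 ys i)) ->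
      eval f ys y -> (forall i, i < size pre -> s (lim + i) = nth 0 ys i) ->
      exists2 s', run (cl hs (lim + size pre)) s s' & s' out = y.
    elim: hs => [|h hs ih] pre s ys y e s0 sz evg evf ev /=.
      rewrite cats0 in e; rewrite -e addKn; apply: (hf _ _ _ scf).2 => //.
      suff -> : map s (iota lim (size gs)) = ys by [].
      apply: (@eq_from_nth _ 0); first by rewrite size_map size_iota.
      move=> i; rewrite size_map size_iota => lti.
      by rewrite (nth_map 0) ?size_iota // nth_iota // ev // -e.
    have evh : eval h (map s args) (nth 0 ys (size pre)).
      have := evg (size pre); rewrite {1 2}e size_cat nth_cat ltnn subnn /=.
      by apply; lia.
    have [t r1 tj] := (hg _ _ _ e _ _ _ (scg _ _ _ e)).2 _ _ s0 evh.
    have [_ ag] := (hg _ _ _ e _ _ _ (scg _ _ _ e)).1 _ _ r1 s0.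
    have st r : r < lim -> t r = s r.
      by apply: (agree_fresh ag); rewrite /lim'; lia.
    have em := map_below ltargs st.
    have e' : gs = rcons pre h ++ hs by rewrite cat_rcons.
    have [||i lti||i|s' r2 s'o] := ih (rcons pre h) t ys y e'.
    + by rewrite st //; lia.
    + exact: sz.
    + by rewrite em; apply: evg.
    + exact: evf.
    + rewrite size_rcons ltnS leq_eqVlt => /orP[/eqP->|lti] //.
      rewrite -ev //.
      by apply: ag; rewrite /lim' ?e ?size_cat /=; lia.
    + exists s' => //; apply: run_seq r1 _.
      by rewrite size_rcons addnS in r2.
  move=> s y s0 ev; inversion ev as [| | |? ? ? ys ? sz evg evf| | |]; subst.
  have := cpl gs [::] s ys y erefl s0 sz evg evf.
  by rewrite addn0; apply.
Qed.

Lemma run_guessE r s s' : run (guess r) s s' -> forall x, x != r -> s' x = s x.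
Proof.
move=> /run_seqE[t /run_atomE[_ ->]] h x ne.
have -> : s x = act (asg r 0 0) s x by rewrite /= /upd (negPf ne).
move: h; apply: (run_star_ind (P := fun s s' : store => s' x = s x)) => //.
by move=> u v w /run_atomE[_ ->] ->; rewrite /= /upd (negPf ne).
Qed.

Lemma run_guess r s v : s 0 = 0 -> exists2 s', run (guess r) s s' &
  s' r = v /\ forall x, x != r -> s' x = s x.
Proof.
move=> s0; suff [s' r1 e] : exists2 s', run (Star (Atom (asg r r 1)))
    (act (asg r 0 0) s) s' & s' r = v.
  have r2 : run (guess r) s s' by apply: run_seq r1; apply: run_atom.
  by exists s' => //; split=> //; apply: run_guessE.
have gen k (t : store) : exists2 s', run (Star (Atom (asg r r 1))) t s' &
    s' r = t r + k.
  elim: k t => [|k ih] t; first by exists t; [exact: run_star0|rewrite addn0].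
  have [s' r1 e] := ih (act (asg r r 1) t); exists s'.
    by apply: run_starS r1; apply: run_atom.
  by rewrite e /= /upd eqxx; lia.
have [s' r1 e] := gen v (act (asg r 0 0) s); exists s' => //.
by rewrite e /= /upd eqxx s0.
Qed.

Lemma run_star_rcons p s t u : run (Star p) s t -> run p t u -> run (Star p) s u.
Proof.
move=> h1 h2; move: h1 u h2.
apply: (run_star_ind (P := fun s t => forall u, run p t u -> run (Star p) s u)).
  move=> {}s u h; apply: run_starS h (run_star0 _ _).
move=> {}s v w h1 ih u /ih.
exact: run_starS.
Qed.

(** Finite choice, by induction; [eval_mu] asks for the nonzero values as a function. *)
Lemma bounded_choice (P : nat -> nat -> Prop) n :
  (forall i, i < n -> exists z, P i z) ->
  exists g : nat -> nat, forall i, i < n -> P i (g i).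
Proof.
elim: n => [|n ih] h; first by exists id.
have [|g hg] := ih; first by move=> i lti; apply: h; lia.
have [z hz] := h n (ltnSn n).
exists (fun i => if i == n then z else g i) => i; rewrite ltnS leq_eqVlt.
by case: eqP => [->|_] //=; apply: hg.
Qed.

(** Tests are equalities, so [v] is shown to be nonzero by guessing its predecessor [t]. The loop
    may stop at any index, but only one with value 0 passes the final test. *)
Lemma compiled_mu f : compiled f -> compiled (Mu f).
Proof.
move=> hf args out lim sc.
have lta := scoped_lt sc; have /and3P[_ op ol] := sc.
have scf : scoped (lim :: args) lim.+1 lim.+3.
  apply: (@scoped_fresh _ lim.+1); try lia.
  by rewrite /= ltnSn; apply: sub_all lta => a /= al; lia.
rewrite /=; set body := (X in Star X); set fin := (X in _ ;; Star _ ;; X).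
split.
- move=> s s' /run_seqE[s1 /run_atomE[_ ->] /run_seqE[u ru rf]] s0.
  pose inv (u : store) := [/\ u 0 = 0, forall r, r < lim -> u r = s r &
    forall j, j < u lim -> exists z, eval f (j :: map s args) z.+1].
  have step u1 : inv u1 ->
      forall u2, run (compile f (lim :: args) lim.+1 lim.+3) u1 u2 ->
      eval f (u1 lim :: map s args) (u2 lim.+1) /\
      forall r, r <= lim -> u2 r = u1 r.
    move=> [z fr _] u2 /(hf _ _ _ scf).1 -/(_ z)[] /=.
    rewrite (map_below lta fr) => ev ag; split=> // r rl.
    by apply: ag; lia.
  have [u0 fr ev] : inv u.
    move: ru; set s2 := act _ _; have : inv s2.
      rewrite /s2 /inv /= /upd eqxx s0; split=> //; first by case: eqP => //; lia.
      by move=> r rl; case: eqP => //; lia.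
    move=> inv2 ru; move: ru inv2.
    apply: (run_star_ind (P := fun s t => inv s -> inv t)) => //.
    move=> {s2 u rf} u1 u2 u3 /run_seqE[t1 /[swap] /run_seqE[t2 /run_guessE t2E]].
    move=> /run_seqE[t3 /run_atomE[/= /eqP tv ->] /run_atomE[_ ->]] rf ih inv1.
    apply: ih; have [ev fr1] := step _ inv1 _ rf; have [z fr evs] := inv1.
    have fr2 r : r <= lim -> t2 r = u1 r by move=> rl; rewrite t2E ?fr1 //; lia.
    split=> [|r rl|j].
    + by rewrite /= /upd; case: eqP => ?; rewrite fr2 //; lia.
    + by rewrite /= /upd; case: eqP => ?; rewrite fr2 ?fr //; lia.
    + rewrite /= /upd eqxx addn1 ltnS fr2 // leq_eqVlt => /orP[/eqP->|/evs //].
      exists (t2 lim.+2); move: tv; rewrite t2E; last by lia.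
      by rewrite addn1 => <-.
  move: rf => /run_seqE[u1 r1] /run_seqE[? /run_atomE[/= /eqP v0 ->]].
  move=> /run_atomE[_ ->] /=; have iu : inv u by [].
  have [ev1 fr1] := step _ iu _ r1.
  rewrite /upd eqxx addn0 fr1 //; split.
    have [g hg] := bounded_choice ev; apply: eval_mu hg _.
    by move: ev1; rewrite v0 addn0 fr1 // u0.
  by move=> r rl /negPf ->; rewrite fr1 ?fr //; lia.
- move=> s y s0 ev.
  inversion ev as [| | | | | |? g ? ? pos zero]; subst.
  have step (u : store) z : u 0 = 0 -> (forall r, r < lim -> u r = s r) ->
      eval f (u lim :: map s args) z ->
      exists2 u', run (compile f (lim :: args) lim.+1 lim.+3) u u' &
      u' lim.+1 = z /\ forall r, r <= lim -> u' r = u r.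
    move=> u0 fr evz.
    have [|u' r1 uz] := (hf _ _ _ scf).2 u z u0.
      by rewrite /= (map_below lta fr).
    exists u' => //; split=> // r rl.
    by apply: ((hf _ _ _ scf).1 _ _ r1 u0).2; lia.
  have loop k : forall u : store, u lim + k = y -> u 0 = 0 ->
     (forall r, r < lim -> u r = s r) ->
     exists2 u', run (Star body) u u' &
     [/\ u' lim = y, u' 0 = 0 & forall r, r < lim -> u' r = s r].
    elim: k => [|k ih] u uk u0 fr.
      by exists u; [exact: run_star0|split=> //; lia].
    have [|u1 r1 [v1 fr1]] := step u (g (u lim)).+1 u0 fr; first by apply: pos; lia.
    have [|u2 r2 [v2 u2E]] := @run_guess lim.+2 u1 (g (u lim)); first by rewrite fr1.
    have fr2 r : r <= lim -> u2 r = u r by move=> rl; rewrite u2E ?fr1 //; lia.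
    have [|||u' r3 inv'] := ih (act (asg lim lim 1) u2).
    + by rewrite /= /upd eqxx fr2 //; lia.
    + by rewrite /= /upd; case: eqP => ?; rewrite fr2 //; lia.
    + by move=> r rl; rewrite /= /upd; case: eqP => ?; rewrite fr2 ?fr //; lia.
    exists u' => //; apply: run_starS r3; apply: run_seq r1 _.
    apply: run_seq r2 _; apply: run_seq (run_atom _) (run_atom _) => //=.
    by rewrite v2 u2E ?v1; lia.
  have [|||u ru [ul u0 fr]] := loop y (act (asg lim 0 0) s).
  + by rewrite /= /upd eqxx s0.
  + by rewrite /= /upd; case: eqP => //; lia.
  + by move=> r rl; rewrite /= /upd; case: eqP => //; lia.
  have [|u1 r1 [v1 fr1]] := step u 0 u0 fr; first by rewrite ul.
  exists (upd u1 out y); last by rewrite /upd eqxx.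
  apply: run_seq (run_atom _) _ => //; apply: run_seq ru _.
  apply: run_seq r1 _; apply: run_seq (run_atom _) _ => /=; first by rewrite v1 fr1 ?u0.
  have -> : upd u1 out y = act (asg out lim 0) u1 by rewrite /= addn0 fr1 // ul.
  exact: run_atom.
Qed.

Lemma eval_precE f g n xs y : eval (Prec f g) (n :: xs) y ->
  if n is m.+1 then exists2 z, eval (Prec f g) (m :: xs) z & eval g [:: m, z & xs] y
  else eval f xs y.
Proof. by move=> ev; inversion ev; subst => //; exists z. Qed.

(** The number of iterations is chosen by [Star] and compared with [n] afterwards; the invariant is
    that [acc] holds the value of the recursion at [i]. *)
Lemma compiled_prec f g : compiled f -> compiled g -> compiled (Prec f g).
Proof.
move=> hf hg [|n args] out lim sc.
  split=> [s s' r s0|s y s0 ev]; first by case: (run_abort s0 r).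
  by inversion ev.
have /= /andP[nl lta] := scoped_lt sc; have /and3P[_ op ol] := sc.
have scf : scoped args lim.+1 lim.+3 by apply: scoped_fresh lta _ _; lia.
have scg : scoped [:: lim, lim.+1 & args] lim.+2 lim.+3.
  apply: (@scoped_fresh _ lim.+2); try lia.
  rewrite /= ltnSn ltnS leqnSn; apply: sub_all lta => a /= al; lia.
rewrite /=; set body := (X in Star X); set fin := (X in _ ;; _ ;; Star _ ;; X).
have stepf (u u' : store) : u 0 = 0 -> run (compile f args lim.+1 lim.+3) u u' ->
    eval f (map u args) (u' lim.+1) /\ forall r, r <= lim -> u' r = u r.
  move=> u0 /(hf _ _ _ scf).1 -/(_ u0)[ev ag]; split=> // r rl.
  by apply: ag; lia.
have stepg (u u' : store) : u 0 = 0 ->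
    run (compile g [:: lim, lim.+1 & args] lim.+2 lim.+3) u u' ->
    eval g [:: u lim, u lim.+1 & map u args] (u' lim.+2) /\
    forall r, r <= lim -> u' r = u r.
  move=> u0 /(hg _ _ _ scg).1 -/(_ u0)[ev ag]; split=> // r rl.
  by apply: ag; lia.
split.
- move=> s s' /run_seqE[? /run_atomE[_ ->] /run_seqE[u1 r1 /run_seqE[u ru rf]]] s0.
  set s1 := act _ _ in r1; have s1E r : r < lim -> s1 r = s r.
    by move=> rl; rewrite /s1 /= /upd; case: eqP => //; lia.
  have s1l : s1 lim = 0 by rewrite /s1 /= /upd eqxx s0.
  pose inv (u : store) := [/\ u 0 = 0, forall r, r < lim -> u r = s r &
    eval (Prec f g) (u lim :: map s args) (u lim.+1)].
  have s10 : s1 0 = 0 by rewrite s1E //; lia.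
  have [ev1 fr1] := stepf _ _ s10 r1.
  have [u0 fr ev] : inv u.
    have : inv u1; last move: ru.
      split=> [|r rl|]; try by rewrite fr1 ?s1E //; lia.
      by rewrite fr1 // s1l; apply: eval_prec0; rewrite -(map_below lta s1E).
    apply: (run_star_ind (P := fun s t => inv s -> inv t)) => // {u1 u rf r1 ev1 fr1} u1 u2 u3 /run_seqE[t1 rg].
    move=> /run_seqE[? /run_atomE[_ ->] /run_atomE[_ ->]] ih [z fr ev].
    apply: ih; have [evg frg] := stepg _ _ z rg; split=> [|r rl|].
    + by rewrite /= /upd; do !case: eqP => ? //; rewrite ?frg //; lia.
    + by rewrite /= /upd; do !case: eqP => ? //; rewrite ?frg ?fr //; lia.
    + rewrite /= /upd !eqxx; do !(case: eqP => ?; try lia).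
      rewrite addn0 addn1 frg //; apply: eval_precS ev _.
      by rewrite -(map_below lta fr).
  move: rf => /run_seqE[? /run_atomE[/= /eqP tl ->] /run_atomE[_ ->]] /=.
  rewrite /upd eqxx addn0; split; last by move=> r rl /negPf ->; apply: fr.
  by move: ev; rewrite tl addn0 fr.
- move=> s y s0; set s1 := act (asg lim 0 0) s => ev.
  have s1E r : r < lim -> s1 r = s r.
    by move=> rl; rewrite /s1 /= /upd; case: eqP => //; lia.
  have s1l : s1 lim = 0 by rewrite /s1 /= /upd eqxx s0.
  have s10 : s1 0 = 0 by rewrite s1E //; lia.
  have loop k : forall z, eval (Prec f g) (k :: map s args) z -> exists u1 u,
      [/\ run (compile f args lim.+1 lim.+3) s1 u1, run (Star body) u1 u,
        u lim = k, u lim.+1 = z & forall r, r < lim -> u r = s r].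
    elim: k => [|k ih] z /eval_precE.
      rewrite -(map_below lta s1E) => evf; have [u ru uz] := (hf _ _ _ scf).2 _ _ s10 evf.
      have [_ fr] := stepf _ _ s10 ru; exists u, u; split=> //.
      + exact: run_star0.
      + by rewrite fr.
      + by move=> r rl; rewrite fr ?s1E //; lia.
    move=> [z' /ih[u1 [u [r1 r2 ul uz' fr]]] evg].
    have u0 : u 0 = 0 by rewrite fr //; lia.
    have [|t rt tz] := (hg _ _ _ scg).2 u z u0; first by rewrite /= ul uz' (map_below lta fr).
    have [_ frt] := stepg _ _ u0 rt.
    exists u1, (act (asg lim lim 1) (act (asg lim.+1 lim.+2 0) t)); split=> //.
    + apply: run_star_rcons r2 _; apply: run_seq rt _.
      by apply: run_seq (run_atom _) (run_atom _).
    + by rewrite /= /upd eqxx; case: eqP => ?; rewrite ?frt ?ul; lia.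
    + by rewrite /= /upd eqxx; case: eqP => ?; rewrite ?tz; lia.
    + by move=> r rl; rewrite /= /upd; do !case: eqP => ? //; rewrite ?frt ?fr //; lia.
  have [u1 [u [r1 r2 ul uy fr]]] := loop _ _ ev.
  exists (upd u out y); last by rewrite /upd eqxx.
  apply: run_seq (run_atom _) _ => //; apply: run_seq r1 _; apply: run_seq r2 _.
  apply: run_seq (run_atom _) _ => /=; first by rewrite ul (fr n nl) addn0.
  have -> : upd u out y = act (asg out lim.+1 0) u by rewrite /= addn0 uy.
  exact: run_atom.
Qed.

Lemma compileP f : compiled f.
Proof.
elim/recf_nested_ind: f.
- exact: compiled_zero.
- exact: compiled_succ.
- exact: compiled_proj.
- exact: compiled_comp.
- exact: compiled_prec.
- exact: compiled_mu.
Qed.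

(** * Search for arguments by guessing *)

Definition guesses (rs : seq nat) (p : prog) : prog :=
  foldr (fun r q => guess r ;; q) p rs.

Lemma run_guessesE rs p s s' : run (guesses rs p) s s' ->
  exists2 t, run p t s' & forall r, r \notin rs -> t r = s r.
Proof.
elim: rs s => [|r rs ih] s /=; first by exists s.
move=> /run_seqE[t /run_guessE tE /ih[u ru uE]]; exists u => // x.
by rewrite inE negb_or => /andP[xr xrs]; rewrite uE // tE.
Qed.

Lemma run_guesses rs (xs : seq nat) (s : store) : uniq rs -> 0 \notin rs ->
  size xs = size rs -> s 0 = 0 -> exists t : store,
  [/\ map t rs = xs, forall r, r \notin rs -> t r = s r &
      forall p s', run p t s' -> run (guesses rs p) s s'].
Proof.
elim: rs xs s => [|r rs ih] [|x xs] s //=; first by exists s.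
rewrite inE negb_or => /andP[rrs urs] /andP[r0 rs0] [sz] s0.
have [t rt [tr tE]] := run_guess r x s0.
have [|u [um uE ur]] := ih xs t urs rs0 sz; first by rewrite tE.
exists u; split=> [|y|p s' /ur].
- by rewrite um uE // tr.
- by rewrite inE negb_or => /andP[yr yrs]; rewrite uE // tE.
- exact: run_seq rt.
Qed.

(* Guessing the arguments avoids programming the inverse of enc.  Register 1 is
   the input. *)
Definition search k (enc b : recf) : prog :=
  guesses (iota 2 k)
    (compile enc (iota 2 k) k.+2 k.+3 ;; Atom (tst k.+2 1 0) ;;
     compile b (iota 2 k) k.+2 k.+3).

Definition input (c : nat) : store := fun r => if r == 1 then c else 0.

Lemma searchP k enc b c :
  (exists s', run (search k enc b) (input c) s') <->
  (exists xs, [/\ size xs = k, eval enc xs c & exists y, eval b xs y]).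
Proof.
have sc : scoped (iota 2 k) k.+2 k.+3.
  apply/and3P; split; try lia.
  by apply/allP => a; rewrite mem_iota; lia.
have fr (t u : store) :
    (forall r, r < k.+2 -> u r = t r) -> map u (iota 2 k) = map t (iota 2 k).
  by move=> h; apply/eq_in_map => a; rewrite mem_iota => ?; apply: h; lia.
split=> [[s' /run_guessesE[t /run_seqE[u r1 /run_seqE[? /run_atomE[/= /eqP e ->] r2]] tE]]
        | [xs [sz ev [y evy]]]].
- have t0 : t 0 = 0 by rewrite tE // mem_iota.
  have t1 : t 1 = c by rewrite tE // mem_iota.
  have [ev1 ag1] := (compileP enc sc).1 _ _ r1 t0.
  have u0 : u 0 = 0 by rewrite ag1.
  have [ev2 _] := (compileP b sc).1 _ _ r2 u0.
  exists (map t (iota 2 k)); split; first by rewrite size_map size_iota.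
    by move: ev1; rewrite e addn0 ag1 // t1.
  exists (s' k.+2); rewrite -(fr t u) // => r rk.
  by apply: ag1; lia.
- have [||||t [tm tE tr]] := @run_guesses (iota 2 k) xs (input c).
  + exact: iota_uniq.
  + by rewrite mem_iota.
  + by rewrite size_iota.
  + by [].
  have t0 : t 0 = 0 by rewrite tE // mem_iota.
  have t1 : t 1 = c by rewrite tE // mem_iota.
  rewrite -tm in ev evy.
  have [u ru ue] := (compileP enc sc).2 _ _ t0 ev.
  have ag := ((compileP enc sc).1 _ _ ru t0).2.
  have [||s' rs' _] := (compileP b sc).2 u y; first by rewrite ag.
    by rewrite (fr t u) // => r rk; apply: ag; lia.
  exists s'; apply: tr; apply: run_seq ru _; apply: run_seq rs'.
  by apply: run_atom; rewrite /= ue ag // t1 addn0.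
Qed.

Lemma searchE k enc b c : let p := search k enc b in
  (exists s', flat (edges p 0) 0 (input c) (width p) s') <->
  (exists xs, [/\ size xs = k, eval enc xs c & exists y, eval b xs y]).
Proof.
move=> p; rewrite -searchP; split=> -[s' h]; exists s'; first exact: flat_sound h.
exact: (flat_complete 0).
Qed.

Import Order.TTheory GRing.Theory Num.Theory.
Local Open Scope ring_scope.

(** * The weighted cost of a word *)

(* A linear form on sequences nat -> int, as a list of (index, coefficient). *)
Definition form : Type := seq (nat * int).
Definition fval (l : form) (x : nat -> int) : int := \sum_(p <- l) p.2 * x p.1.
Definition fcoef (l : form) (j : nat) : int := \sum_(p <- l) p.2 *+ (p.1 == j).

Lemma fvalE n l (x : nat -> int) : all (fun p => p.1 < n)%N l ->
  \sum_(j < n) x j * fcoef l j = fval l x.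
Proof.
elim: l => [|[k c] l ih] /=.
  by move=> _; rewrite /fval big_nil big1 // => j _; rewrite /fcoef big_nil mulr0.
move=> /andP[kn /ih {}ih]; rewrite /fval big_cons /= -/(fval l x) -ih.
have -> : c * x k = \sum_(j < n) x j * (c *+ (k == j)).
  rewrite (bigD1 (Ordinal kn)) //= eqxx mulrC big1 ?addr0 // => j.
  by rewrite -val_eqE /= eq_sym => /negPf ->; rewrite mulr0.
by rewrite -big_split; apply: eq_bigr => j _; rewrite /fcoef big_cons mulrDr.
Qed.

(* Coordinate 0 is constant, which makes affine maps linear. *)
Definition config (pc : nat) (s : store) (j : nat) : int :=
  match j with 0 => 1 | 1 => pc%:Z | r.+2 => (s r)%:Z end.

Section Machine.
Variables (E : seq edge) (h : nat).

(* The letter None halts the machine, Some i takes the edge number i. *)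
Definition letter : finType := option 'I_(size E).

Definition edge_of (i : 'I_(size E)) : edge := tnth (in_tuple E) i.

Definition update (a : letter) (j : nat) : form :=
  if a is Some i then
    let: (_, (b, r, t, d), q) := edge_of i in
    if j == 1%N then [:: (0%N, q%:Z)]
    else if b && (j == r.+2) then [:: (t.+2, 1); (0%N, d%:Z)] else [:: (j, 1)]
  else [::].

Definition guard_pc (a : letter) : form :=
  let p := if a is Some i then (edge_of i).1.1 else h in
  [:: (1%N, 1); (0%N, - p%:Z)].

Definition guard_test (a : letter) : form :=
  if a is Some i then
    let: (_, (b, r, t, d), _) := edge_of i in
    if b then [::] else [:: (r.+2, 1); (t.+2, -1); (0%N, - d%:Z)]
  else [::].

Definition next (a : letter) (x : nat -> int) : nat -> int :=
  fun j => fval (update a j) x.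

(* The letter None also sends the configuration to 0, so that what follows it
   costs nothing. *)
Definition cost (a : letter) (x : nat -> int) : int :=
  fval (guard_pc a) x ^+ 2 + fval (guard_test a) x ^+ 2 - x 0%N ^+ 2 *+ (a == None).

Fixpoint total (x : nat -> int) (w : seq letter) : int :=
  if w is a :: w' then cost a x + total (next a x) w' else 0.

Lemma fval_ext l x y : x =1 y -> fval l x = fval l y.
Proof. by move=> e; apply: eq_bigr => p _; rewrite e. Qed.

Lemma total_ext x y w : x =1 y -> total x w = total y w.
Proof.
elim: w x y => //= a w ih x y e; rewrite /cost !(fval_ext _ e) e.
by congr (_ + _); apply: ih => j; exact: fval_ext.
Qed.

Lemma total0 w : total (fun _ => 0) w = 0.
Proof.
have f0 l : fval l (fun _ => 0) = 0.
  by rewrite /fval big1 // => p _; rewrite mulr0.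
elim: w => //= a w ih; rewrite /cost !f0 expr0n mul0rn subrr add0r -[RHS]ih.
by apply: total_ext => j; exact: f0.
Qed.

Lemma total_rcons x w a :
  total x (rcons w a) = total x w + cost a (foldl (fun y b => next b y) x w).
Proof.
elim: w x => [|b w ih] x /=; first by rewrite addr0 add0r.
by rewrite ih addrA.
Qed.

Lemma cost_halt pc s : cost None (config pc s) = (pc%:Z - h%:Z) ^+ 2 - 1.
Proof.
by rewrite /cost /fval /= !big_cons !big_nil /= !(mul1r, mulr1, addr0, expr0n) expr1n.
Qed.

Lemma total_halt pc s w :
  total (config pc s) (None :: w) = (pc%:Z - h%:Z) ^+ 2 - 1.
Proof.
rewrite /= cost_halt (@total_ext _ (fun _ => 0)) ?total0 ?addr0 // => j.
by rewrite /next /fval big_nil.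
Qed.

Lemma next_config i pc s :
  next (Some i) (config pc s) =1 config (edge_of i).2 (act (edge_of i).1.2 s).
Proof.
rewrite /next /update; case: (edge_of i) => [[p [[[b r] t] d]] q] /= j.
have [->|j1] /= := eqVneq j 1%N; first by rewrite /fval big_seq1 mulr1.
have [->|jr] := eqVneq j r.+2; case: b => /=.
- by rewrite /fval !big_cons big_nil /= /upd eqxx mul1r mulr1 addr0 PoszD.
- by rewrite /fval big_seq1 mul1r.
- rewrite /fval big_seq1 mul1r; case: j j1 jr => [|[|j]] //= _ jr.
  by rewrite /upd (_ : (j == r) = false) //; apply: negPf jr.
- by rewrite /fval big_seq1 mul1r; case: j j1 jr => [|[|j]].
Qed.

Lemma cost_edge i pc s : 0 <= cost (Some i) (config pc s) ?= iff
  (pc == (edge_of i).1.1) && enabled (edge_of i).1.2 s.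
Proof.
rewrite /cost /guard_pc /guard_test /= subr0; case: (edge_of i) => [[p [[[b r] t] d]] q] /=.
rewrite -[0]addr0; apply: leifD.
  split; first exact: sqr_ge0.
  rewrite eq_sym sqrf_eq0 /fval !big_cons big_nil /= mul1r mulr1 addr0 subr_eq0.
  exact: eqz_nat.
split; first exact: sqr_ge0.
rewrite eq_sym sqrf_eq0; case: b; rewrite /fval !(big_cons, big_nil) //=.
rewrite mul1r mulN1r mulr1 addr0 -opprD subr_eq0 -PoszD.
exact: eqz_nat.
Qed.

(** An edge letter costs a sum of squares. Only [None] may have a negative cost, at least -1, and
    nothing after it counts. *)
Lemma total_ge pc s w : -1 <= total (config pc s) w.
Proof.
elim: w pc s => // -[i|] w ih pc s; last first.
  by rewrite total_halt; have := sqr_ge0 (pc%:Z - h%:Z); lia.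
rewrite /= (total_ext _ (next_config i pc s)).
have [c0 _] := cost_edge i pc s.
by rewrite -[-1]add0r lerD.
Qed.

Lemma total_neg pc s w : total (config pc s) w < 0 -> exists s', flat E pc s h s'.
Proof.
elim: w pc s => // -[i|] w ih pc s; last first.
  rewrite total_halt => lt0; have -> : pc = h; last by exists s; exact: flat0.
  have : (pc%:Z - h%:Z) ^+ 2 = 0 by have := sqr_ge0 (pc%:Z - h%:Z); lia.
  by move/eqP; rewrite sqrf_eq0 subr_eq0 => /eqP[].
rewrite /= (total_ext _ (next_config i pc s)) => lt0.
have [c0 ce] := cost_edge i pc s.
have ge := total_ge (edge_of i).2 (act (edge_of i).1.2 s) w.
have aux (u v : int) : 0 <= u -> -1 <= v -> u + v < 0 -> u = 0 by lia.
have c0' := aux _ _ c0 ge lt0.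
move: ce; rewrite c0' eqxx => /esym/andP[/eqP epc en].
rewrite c0' add0r in lt0; have [s' fl] := ih _ _ lt0; exists s'.
move: epc en fl (mem_tnth i (in_tuple E)); rewrite -/(edge_of i).
by case: (edge_of i) => [[p x] q] /= -> en fl mem; apply: flatS mem en fl.
Qed.

Lemma flat_total pc s q s' : flat E pc s q s' -> q = h ->
  exists w, total (config pc s) w < 0.
Proof.
elim=> {pc s q s'} [pc s ->|p x q s r s' pE en _ ih /ih[w lt0]].
  by exists [:: None]; rewrite total_halt subrr.
have [i ei] : exists i, edge_of i = (p, x, q).
  by have /tnthP[i ->] : (p, x, q) \in in_tuple E := pE; exists i.
exists (Some i :: w); rewrite /= (total_ext _ (next_config i p s)) ei /=.
have [_] := cost_edge i p s; rewrite ei /= eqxx en => /eqP <-.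
by rewrite add0r.
Qed.

Lemma totalP s : (exists w, total (config 0 s) w < 0) <->
  exists s', flat E 0 s h s'.
Proof.
split=> [[w]|[s' fl]]; first exact: total_neg.
exact: flat_total fl erefl.
Qed.
End Machine.

(** * From weighted automata to Markov decision processes *)

Lemma big_option (R : nmodType) (T : finType) (F : option T -> R) :
  \sum_x F x = F None + \sum_x F (Some x).
Proof.
by rewrite ![index_enum _]unlock [@Finite.enum in LHS]unlock /= big_cons big_map.
Qed.

Lemma big_pairE (R : nmodType) (S T : finType) (F : S * T -> R) :
  \sum_p F p = \sum_x \sum_y F (x, y).
Proof. by rewrite pair_big; apply: eq_bigr => -[]. Qed.

(** * Probabilities of states and moves along a word *)

Section Masses.
Variables (R : realType) (L Q : finType).
Implicit Types (w : seq L) (F G : lpath L Q -> R).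

(** The length [n] is separate from [w], so that the type of the tuples does not mention
    [size (rcons w a)] in recursions. *)
Definition psum n w F : R :=
  \sum_(rho : Q * n.-tuple (L * Q) | trace (rho.1, tval rho.2) == w)
     F (rho.1, tval rho.2).

Lemma psum_rcons n w a F : psum n.+1 (rcons w a) F =
  psum n w (fun rho => \sum_q F (rho.1, rcons rho.2 (a, q))).
Proof.
rewrite /psum.
pose h (p : (Q * n.-tuple (L * Q)) * (L * Q)) : Q * n.+1.-tuple (L * Q) :=
  (p.1.1, [tuple of rcons p.1.2 p.2]).
have bij_h : bijective h.
  apply: inj_card_bij; last by rewrite !card_prod !card_tuple !card_prod expnSr mulnA.
  move=> [[q s] x] [[q' s'] x'] [-> /rcons_inj[e ->]].
  by congr ((_, _), _); apply: val_inj.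
rewrite (reindex h) /=; last exact: onW_bij.
transitivity (\sum_(p : (Q * n.-tuple (L * Q)) * (L * Q) | (trace (p.1.1, tval p.1.2) == w) && (p.2.1 == a))
   F (p.1.1, rcons (tval p.1.2) p.2)).
  by apply: eq_bigl => -[[q s] [b q']]; rewrite /trace /unzip1 /= map_rcons eqseq_rcons.
rewrite -(pair_big (fun rho : Q * n.-tuple (L * Q) => trace (rho.1, tval rho.2) == w)
   (fun x : L * Q => x.1 == a) (fun rho x => F (rho.1, rcons (tval rho.2) x))) /=.
apply: eq_bigr => rho _.
transitivity (\sum_(b | b == a) \sum_q F (rho.1, rcons (tval rho.2) (b, q))).
  rewrite (pair_big (fun b => b == a) xpredT
    (fun b q => F (rho.1, rcons (tval rho.2) (b, q)))) /=.
  by apply: eq_big => [[b q]|[b q] _] //=; rewrite andbT.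
by rewrite big_pred1_eq.
Qed.

Variables (D : mdp L Q) (alpha : lpath L Q -> {ffun L * Q -> rat} -> R).
Hypothesis strat : is_strategy D alpha.

Notation prob := (path_prob D alpha).

Definition mass w q : R :=
  psum (size w) w (fun rho => prob rho *+ (last_state rho == q)).

(** Probability that the trace is [w], the state reached is [q] and the move chosen there is [m].
    These numbers determine all masses, hence all trace probabilities, by linear equations. *)
Definition flow w q (m : {ffun L * Q -> rat}) : R :=
  psum (size w) w (fun rho => prob rho * alpha rho m *+ (last_state rho == q)).

Lemma dist_ge0 (T : finType) (d : {ffun T -> rat}) x : is_dist d -> 0 <= d x.
Proof. by case/andP=> /forallP. Qed.

Lemma path_prob_ge0 rho : 0 <= prob rho.
Proof.
case: rho => q0 s; elim/last_ind: s => [|s [a q] ih].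
  by rewrite path_prob0 ler0q dist_ge0 ?init_dist.
rewrite path_prob_rcons mulr_ge0 // big_seq sumr_ge0 // => m mq.
rewrite mulr_ge0 //; first exact: (strat (q0, s)).1.
by rewrite ler0q (dist_ge0 _ (moves_dist mq)).
Qed.

Lemma Tr_mass w : Tr D alpha w = \sum_q mass w q.
Proof.
rewrite /mass /psum exchange_big /=; apply: eq_bigr => rho _.
by rewrite (bigD1 (last_state (rho.1, tval rho.2))) //= eqxx big1 ?addr0 // => q /negPf;
   rewrite eq_sym => ->.
Qed.

Lemma mass0 q : mass [::] q = ratr (init D q).
Proof.
rewrite /mass /psum /=.
rewrite (eq_bigl (fun rho => true && true)) //; last first.
  by move=> [q' s] /=; rewrite (tuple0 s) /=.
rewrite -(pair_big xpredT xpredT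
  (fun q' (s : 0.-tuple (L * Q)) => prob (q', tval s) *+ (last_state (q', tval s) == q))) /=.
rewrite (bigD1 q) //= [X in _ + X]big1 ?addr0 => [|q' /negPf ne]; last first.
  by apply: big1 => s _; rewrite (tuple0 s) /last_state /= ne.
rewrite (big_pred1 [tuple]) => [|s]; last by rewrite (tuple0 s) /= eqxx.
by rewrite /last_state /= eqxx path_prob0.
Qed.

Lemma mass_rcons w a q' :
  mass (rcons w a) q' = \sum_q \sum_(m <- moves D q) flow w q m * ratr (m (a, q')).
Proof.
rewrite /mass size_rcons psum_rcons.
transitivity (psum (size w) w (fun rho => prob rho *
   \sum_(m <- moves D (last_state rho)) alpha rho m * ratr (m (a, q')))).
  apply: eq_bigr => rho _ /=.
  rewrite (bigD1 q') //= {1}/last_state /unzip2 map_rcons last_rcons /= eqxx.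
  rewrite big1 ?addr0 => [|q /negPf ne]; first by rewrite path_prob_rcons.
  by rewrite /last_state /unzip2 map_rcons last_rcons /= ne.
rewrite /psum.
under [RHS]eq_bigr do under eq_bigr do rewrite mulr_suml.
under [RHS]eq_bigr do rewrite exchange_big.
rewrite exchange_big /=; apply: eq_bigr => rho _.
set rho' := (rho.1, _); rewrite (bigD1 (last_state rho')) //=.
rewrite [X in _ + X]big1 ?addr0 => [|q /negPf]; last first.
  by rewrite eq_sym => ne; apply: big1 => m _; rewrite ne mul0r.
by rewrite mulr_sumr; apply: eq_bigr => m _; rewrite eqxx mulrA.
Qed.

Lemma sum_flow w q : \sum_(m <- moves D q) flow w q m = mass w q.
Proof.
rewrite /flow /psum exchange_big /=; apply: eq_bigr => rho _.
case: eqP => [<-|_]; last by rewrite big1.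
by rewrite -mulr_sumr (strat _).2 mulr1.
Qed.

Lemma flow_ge0 w q m : m \in moves D q -> 0 <= flow w q m.
Proof.
move=> mq; apply: sumr_ge0 => rho _; case: eqP => [e|_] //=.
by rewrite mulr1n mulr_ge0 ?path_prob_ge0 // (strat _).1 // e.
Qed.

Lemma mass_ge0 w q : 0 <= mass w q.
Proof. by apply: sumr_ge0 => rho _; rewrite mulrn_wge0 // path_prob_ge0. Qed.

Lemma flow_le w q m : m \in moves D q -> flow w q m <= mass w q.
Proof.
move=> mq; rewrite -sum_flow (big_rem m mq) /= lerDl big_seq sumr_ge0 // => m' m'q.
by apply: flow_ge0; apply: mem_rem m'q.
Qed.

Lemma flow_mass0 w q m : m \in moves D q -> mass w q = 0 -> flow w q m = 0.
Proof.
move=> mq m0; apply/eqP; rewrite eq_le flow_ge0 // andbT -m0.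
exact: flow_le.
Qed.

(** A strategy that sees only the trace and the last state gives the same factor to all paths
    counted in [mass w q]. *)
Lemma flow_markov (r : seq L -> Q -> {ffun L * Q -> rat} -> R) w q m :
  (forall rho m, alpha rho m = r (trace rho) (last_state rho) m) ->
  flow w q m = r w q m * mass w q.
Proof.
move=> ar; rewrite /mass /flow /psum mulr_sumr; apply: eq_bigr => rho /eqP tr.
by rewrite ar tr mulrC; case: eqP => [->|_]; rewrite ?mulr0n ?mulr0.
Qed.

End Masses.

(** * The gadget simulating an integer weighted automaton *)

Section Gadget.
Variables (A T : finType) (W : A -> T -> T -> int) (acc : T).
Variables (v0 : {ffun T -> rat}) (a0 : A).
Hypothesis v0_dist : is_dist v0.

(* The part of the integer z that contributes to the state of the same sign
   (b = true) or of the opposite sign (b = false). *)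
Definition part (b : bool) (z : int) : nat :=
  if (if b then z else - z) is Posz n then n else 0.

Lemma part_sub z : (part true z)%:Z - (part false z)%:Z = z.
Proof. by case: z => [[|n]|n] //=; rewrite /part /= ?subr0 // sub0r NegzE. Qed.

(** Exceeds the sum of the absolute values of all weights. After division by it, rows sum to at most
    1 and the sink takes the remainder. *)
Definition scale : nat :=
  (\sum_a \sum_t \sum_t' (part true (W a t t') + part false (W a t t'))).+1.

(* Labels: None is the letter sharp, Some None is the letter dollar.  States:
   None is initial, Some None is the sink, and (t, b) carries the part of sign b
   of the weight of t. *)
Definition glabel : finType := option (option A).
Definition gstate : finType := option (option (T * bool)).
Definition sharp : glabel := None.
Definition dollar : glabel := Some None.
Definition letter_of (a : A) : glabel := Some (Some a).

(** A positive weight keeps the sign component, a negative one flips it. *)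
Definition move_weight a (x y : T * bool) : rat :=
  (part (x.2 == y.2) (W a x.1 y.1))%:R / scale%:R.

Definition trans a (x y : option (T * bool)) : rat :=
  match x, y with
  | Some x, Some y => move_weight a x y
  | Some x, None => 1 - \sum_y move_weight a x y
  | None, None => 1
  | None, Some _ => 0
  end.

(** Each letter of [A] has probability [kappa] in every noninitial state, 1/2 in all; the other half
    goes to [sharp] or [dollar]. *)
Definition kappa : rat := (2 * #|A|)%:R^-1.

(** [b] selects the ending letter, [sharp] or [dollar], which leads to the sink; the behaviour on
    letters of [A] is the same for both. *)
Definition step_move (b : bool) (x : option (T * bool)) :
    {ffun glabel * gstate -> rat} :=
  [ffun lq => if lq.2 is Some y then
      match lq.1 with
      | Some (Some a) => trans a x y * kappa
      | Some None => 2^-1 *+ (~~ b && (y == None))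
      | None => 2^-1 *+ (b && (y == None))
      end
    else 0].

Definition start_move (b : bool) : {ffun glabel * gstate -> rat} :=
  [ffun lq => if lq is (None, Some (Some (t, b'))) then v0 t *+ (b' == b) else 0].

Definition acc_state : gstate := Some (Some (acc, true)).

(* The choice at the initial state (for c = true) exchanges the two signs; the
   choice at acc_state is between the letters sharp and dollar. *)
Definition gmoves (c : bool) (q : gstate) : seq {ffun glabel * gstate -> rat} :=
  if q is Some x then
    if q == acc_state then [:: step_move true x; step_move false x]
    else [:: step_move false x]
  else if c then [:: start_move true; start_move false] else [:: start_move true].

Local Arguments gmoves : simpl never.

Definition ginit : {ffun gstate -> rat} := [ffun q => (q == None)%:R].

Lemma ginit_dist : is_dist ginit.
Proof.
apply/andP; split; first by apply/forallP => q; rewrite ffunE ler0n.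
rewrite big_option ffunE eqxx big1 ?addr0 // => x _.
by rewrite ffunE.
Qed.

Lemma scale_gt0 : 0 < scale%:R :> rat.
Proof. by rewrite ltr0n. Qed.

Lemma kappa_gt0 : 0 < kappa.
Proof.
rewrite invr_gt0 ltr0n muln_gt0 /=; apply/card_gt0P; by exists a0.
Qed.

Lemma kappa_sum : \sum_(a : A) kappa = 2^-1.
Proof.
rewrite sumr_const -[LHS]mulr_natr /kappa natrM invfM divfK //.
by rewrite pnatr_eq0 -lt0n; apply/card_gt0P; exists a0.
Qed.

Lemma move_weight_ge0 a x y : 0 <= move_weight a x y.
Proof. by rewrite divr_ge0 // ler0n. Qed.

Lemma sum_move_weight a x : \sum_y move_weight a x y <= 1.
Proof.
rewrite -mulr_suml ler_pdivrMr ?scale_gt0 // mul1r -natr_sum ler_nat.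
apply: leqW.
rewrite (bigD1 a) //= (bigD1 x.1) //= -addnA; apply: leq_trans (leq_addr _ _).
rewrite big_pairE /=; apply: leq_sum => t _.
by rewrite big_bool /=; case: x.2; rewrite //= addnC.
Qed.

Lemma trans_ge0 a x y : 0 <= trans a x y.
Proof.
case: x y => [x|] [y|] //=; first exact: move_weight_ge0.
by rewrite subr_ge0 sum_move_weight.
Qed.

Lemma sum_trans a x : \sum_y trans a x y = 1.
Proof.
rewrite big_option; case: x => [x|] /=; first by rewrite subrK.
by rewrite big1 ?addr0.
Qed.

Lemma step_dist b x : is_dist (step_move b x).
Proof.
apply/andP; split.
  apply/forallP => -[l [y|]]; rewrite ffunE //=.
  case: l => [[a|]|]; last 2 first; try by rewrite mulrn_wge0.
  by rewrite mulr_ge0 ?trans_ge0 ?ltW ?kappa_gt0.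
have e l : \sum_q step_move b x (l, q) =
    match l with Some (Some _) => kappa | Some None => 2^-1 *+ ~~ b | None => 2^-1 *+ b end.
  rewrite !big_option !ffunE add0r /= eqxx !andbT.
  case: l => [[a|]|] /=.
  + under eq_bigr do rewrite ffunE /=.
    by rewrite -[RHS]mul1r -(sum_trans a x) big_option mulrDl mulr_suml.
  + by rewrite big1 ?addr0 // => y _; rewrite ffunE /= andbF.
  + by rewrite big1 ?addr0 // => y _; rewrite ffunE /= andbF.
rewrite big_pairE (eq_bigr _ (fun l _ => e l)) !big_option /= kappa_sum.
by apply/eqP; case: b {e} => /=; lra.
Qed.

Lemma start_dist b : is_dist (start_move b).
Proof.
apply/andP; split.
  apply/forallP => -[[l|] [[[t b']|]|]]; rewrite ffunE //=.
  by rewrite mulrn_wge0 // (dist_ge0 _ v0_dist).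
rewrite big_pairE big_option [X in _ + X]big1 ?addr0 => [|l _]; last first.
  by apply: big1 => q _; rewrite ffunE.
rewrite !big_option !ffunE /= !add0r big_pairE.
have /andP[_ /eqP <-] := v0_dist.
apply/eqP; apply: eq_bigr => t _; rewrite big_bool !ffunE.
by case: b; rewrite /= ?addr0 ?add0r.
Qed.

Lemma gmoves_dist c q m : m \in gmoves c q -> is_dist m.
Proof.
rewrite /gmoves; case: q => [x|].
  by case: ifP => _; rewrite !inE; [case/orP|]; move/eqP->; exact: step_dist.
by case: c; rewrite !inE; [case/orP|]; move/eqP->; exact: start_dist.
Qed.

Lemma step_move_neq x : step_move true x != step_move false x.
Proof.
by apply/eqP => /ffunP/(_ (sharp, Some None)); rewrite !ffunE.
Qed.

Lemma start_move_neq : start_move true != start_move false.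
Proof.
apply/eqP => e.
have /andP[_ /eqP] := v0_dist; rewrite big1 => [/eqP|t _]; first by rewrite eq_sym oner_eq0.
by have /ffunP/(_ (sharp, Some (Some (t, true)))) := e; rewrite !ffunE.
Qed.

Lemma gmoves_uniq c q : uniq (gmoves c q).
Proof.
rewrite /gmoves; case: q => [x|]; case: ifP => //= _; rewrite inE andbT.
  exact: step_move_neq.
exact: start_move_neq.
Qed.

Lemma gmoves_neq0 c q : gmoves c q != [::].
Proof. by rewrite /gmoves; case: q => [x|]; case: ifP. Qed.

Definition gadget (c : bool) : mdp glabel gstate :=
  MDP ginit_dist (@gmoves_dist c) (gmoves_uniq c) (gmoves_neq0 c).

(** * Masses in a gadget under a strategy *)

Section Traces.
Variables (R : realType) (c : bool).
Variable alpha : lpath glabel gstate -> {ffun glabel * gstate -> rat} -> R.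
Hypothesis strat : is_strategy (gadget c) alpha.

Notation mass := (mass (gadget c) alpha).
Notation flow := (flow (gadget c) alpha).
Let flow0 := flow_mass0 strat.

(** Probability of choosing [sharp] at the accepting state, the only quantity that a strategy
    controls after its first move. *)
Definition yield (w : seq glabel) : R :=
  flow w acc_state (step_move true (Some (acc, true))).

Lemma acc_moves :
  gmoves c acc_state =
  [:: step_move true (Some (acc, true)); step_move false (Some (acc, true))].
Proof. by rewrite /gmoves eqxx. Qed.

Lemma acc_true : step_move true (Some (acc, true)) \in moves (gadget c) acc_state.
Proof. by rewrite /= acc_moves inE eqxx. Qed.

Lemma yield_ge0 w : 0 <= yield w.
Proof. exact: flow_ge0 acc_true. Qed.

Lemma yield_le w : yield w <= mass w acc_state.
Proof. exact: flow_le acc_true. Qed.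

(** The initial state is never reentered; this provides the hypothesis [mass w None = 0] of the step
    lemmas for nonempty words. *)
Lemma mass_rcons_None w l : mass (rcons w l) None = 0.
Proof.
rewrite mass_rcons big1 // => q _; rewrite big_seq big1 // => m.
suff h : m \in moves (gadget c) q -> m (l, None) = 0.
  by move=> /h ->; rewrite rmorph0 mulr0.
rewrite /= /gmoves; case: q => [x|]; case: ifP => _; rewrite !inE.
- by case/orP=> /eqP->; rewrite ffunE.
- by move/eqP=> ->; rewrite ffunE.
- by case/orP=> /eqP->; rewrite ffunE; case: l.
- by move/eqP=> ->; rewrite ffunE; case: l.
Qed.

Lemma mass_step w l q' : mass w None = 0 ->
  mass (rcons w l) q' =
  \sum_x \sum_(m <- gmoves c (Some x)) flow w (Some x) m * ratr (m (l, q')).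
Proof.
move=> w0; rewrite mass_rcons big_option [X in X + _]big_seq big1 ?add0r //.
by move=> m mq; rewrite flow0 // mul0r.
Qed.

Lemma mass_letter w a y : mass w None = 0 ->
  mass (rcons w (letter_of a)) (Some y) =
  \sum_x mass w (Some x) * ratr (trans a x y * kappa).
Proof.
move=> w0; rewrite mass_step //; apply: eq_bigr => x _.
rewrite -(sum_flow strat) mulr_suml /= /gmoves big_seq [RHS]big_seq.
apply: eq_bigr => m; case: ifP => _; rewrite !inE.
  by case/orP=> /eqP->; rewrite ffunE.
by move/eqP=> ->; rewrite ffunE.
Qed.

Lemma total_letter w a : mass w None = 0 ->
  \sum_y mass (rcons w (letter_of a)) (Some y) =
  (\sum_x mass w (Some x)) * ratr kappa.
Proof.
move=> w0; under eq_bigr do rewrite mass_letter //.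
rewrite exchange_big mulr_suml; apply: eq_bigr => x _ /=.
by rewrite -mulr_sumr -raddf_sum -mulr_suml sum_trans mul1r.
Qed.

Lemma mass_sharp w y : mass w None = 0 ->
  mass (rcons w sharp) (Some y) = (yield w / 2) *+ (y == None).
Proof.
move=> w0; rewrite mass_step // (bigD1 (Some (acc, true))) //= [X in _ + X]big1 => [|x ne].
  rewrite -/acc_state acc_moves !big_cons big_nil !ffunE /= mulr0n rmorph0 mulr0 !addr0.
  by case: (y == None); rewrite ?mulr0n ?rmorph0 ?mulr0 // fmorphV rmorph_nat.
rewrite /gmoves (_ : (Some x == acc_state) = false) ?big_seq1; last first.
  by apply/negbTE; apply: contra ne => /eqP[->].
by rewrite ffunE /= rmorph0 mulr0.
Qed.

Lemma mass_dollar w y : mass w None = 0 ->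
  mass (rcons w dollar) (Some y) =
  ((\sum_x mass w (Some x) - yield w) / 2) *+ (y == None).
Proof.
move=> w0; rewrite mass_step // (bigD1 (Some (acc, true))) //=.
rewrite [in RHS](bigD1 (Some (acc, true))) //=.
rewrite -/acc_state -[mass w acc_state](sum_flow strat) /= acc_moves.
rewrite !big_cons !big_nil !ffunE /= mulr0n rmorph0 mulr0 add0r !addr0.
rewrite addrAC [yield w + _]addrC addrK mulrDl mulrnDl; congr (_ + _).
  by case: (y == None); rewrite ?mulr0n ?rmorph0 ?mulr0 // fmorphV rmorph_nat.
rewrite mulr_suml -sumrMnl; apply: eq_bigr => x ne.
rewrite -(sum_flow strat) /= /gmoves (_ : (Some x == acc_state) = false); last first.
  by apply/negbTE; apply: contra ne => /eqP[->].
rewrite !big_seq1 ffunE /=.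
by case: (y == None); rewrite ?mulr0n ?rmorph0 ?mulr0 // fmorphV rmorph_nat.
Qed.

Definition letters (u : seq A) : seq glabel := map letter_of u.

Definition vstart (b : bool) (x : option (T * bool)) : rat :=
  if x is Some (t, b') then v0 t *+ (b' == b) else 0.

Definition vstep a (v : option (T * bool) -> rat) y : rat :=
  \sum_x v x * (trans a x y * kappa).

Definition vmass b (u : seq A) := foldl (fun v a => vstep a v) (vstart b) u.

Lemma vmass_rcons b u a : vmass b (rcons u a) = vstep a (vmass b u).
Proof. by rewrite /vmass foldl_rcons. Qed.

Definition mix : R := flow [::] None (start_move true).

Lemma start_true : start_move true \in moves (gadget c) None.
Proof. by rewrite /= /gmoves; case: c; rewrite inE eqxx. Qed.

Lemma mass_nil q : mass [::] q = (q == None)%:R.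
Proof. by rewrite mass0 /= ffunE ratr_nat. Qed.

Lemma mix_ge0 : 0 <= mix.
Proof. exact: flow_ge0 start_true. Qed.

Lemma mix_le1 : mix <= 1.
Proof. by have := flow_le strat [::] start_true; rewrite mass_nil. Qed.

Lemma mass_rcons_nil l q' : mass (rcons [::] l) q' =
  \sum_(m <- gmoves c None) flow [::] None m * ratr (m (l, q')).
Proof.
rewrite mass_rcons big_option [X in _ + X]big1 ?addr0 // => x _.
by rewrite big_seq big1 // => m mx; rewrite flow0 ?mul0r // mass_nil.
Qed.

Lemma mass_cons_None l w : mass (l :: w) None = 0.
Proof. by rewrite lastI mass_rcons_None. Qed.

(** The two moves at [acc_state] treat the letters of [A] alike, so only the first move matters: the
    masses mix the two fixed evolutions [vmass], with [mix] the probability of [start_move true]. *)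
Lemma mass_letters u x : mass (sharp :: letters u) (Some x) =
  mix * ratr (vmass true u x) + (1 - mix) * ratr (vmass false u x).
Proof.
elim/last_ind: u x => [|u a ih] x.
  rewrite -[[:: _]]/(rcons [::] sharp) mass_rcons_nil.
  have e b : ratr (start_move b (sharp, Some x)) = ratr (vstart b x) :> R.
    by rewrite ffunE /=; case: x => [[t b']|].
  have := sum_flow strat [::] None; rewrite mass_nil eqxx mulr1n /= /gmoves.
  rewrite /mix; case: (c); rewrite !big_cons !big_nil !addr0 !e /vmass /= => h.
    by rewrite -h [X in X - _]addrC addrK.
  by rewrite h subrr mul0r addr0.
rewrite /letters map_rcons -rcons_cons mass_letter ?mass_cons_None //.
have rs (F : option (T * bool) -> rat) : ratr (\sum_z F z) = \sum_z ratr (F z) :> R.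
  exact: rmorph_sum.
rewrite !vmass_rcons /vstep !rs !mulr_sumr -big_split /=.
apply: eq_bigr => z _; rewrite -/(letters u) ih [ratr (_ * _)]rmorphM.
have aux (l p q s : R) : (l * p + (1 - l) * q) * s = l * (p * s) + (1 - l) * (q * s).
  by ring.
by rewrite !rmorphM /= aux.
Qed.

Lemma total_sharp w : mass w None = 0 ->
  \sum_y mass (rcons w sharp) (Some y) = yield w / 2.
Proof.
move=> w0; rewrite big_option mass_sharp // eqxx mulr1n [X in _ + X]big1 ?addr0 // => x _.
by rewrite mass_sharp.
Qed.

Lemma total_dollar w : mass w None = 0 ->
  \sum_y mass (rcons w dollar) (Some y) = (\sum_x mass w (Some x) - yield w) / 2.
Proof.
move=> w0; rewrite big_option mass_dollar // eqxx mulr1n [X in _ + X]big1 ?addr0 // => x _.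
by rewrite mass_dollar.
Qed.

Lemma yield_Tr u : Tr (gadget c) alpha (rcons (sharp :: letters u) sharp) =
  yield (sharp :: letters u) / 2.
Proof.
by rewrite Tr_mass // big_option mass_rcons_None add0r total_sharp ?mass_cons_None.
Qed.

Lemma mass_start_other l q : l != sharp -> mass [:: l] q = 0.
Proof.
move=> ne; rewrite -[[:: l]]/(rcons [::] l) mass_rcons_nil big_seq big1 // => m.
rewrite /gmoves; case: (c); rewrite !inE; [case/orP|]; move/eqP->;
  by rewrite ffunE; case: l ne => //; rewrite ?rmorph0 ?mulr0.
Qed.

Lemma total_start : \sum_y mass [:: sharp] (Some y) = 1.
Proof.
have e x := mass_letters [::] x; rewrite /= in e.
under eq_bigr do rewrite e /vmass /=.
rewrite big_split /= -!mulr_sumr.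
have s b : \sum_x ratr (vstart b x) = 1 :> R.
  have /andP[_ /eqP v1] := v0_dist.
  rewrite big_option rmorph0 add0r big_pairE -[RHS](rmorph1 (@ratr R)) -v1.
  rewrite [RHS]rmorph_sum; apply: eq_bigr => t _; rewrite big_bool /=.
  by case: b; rewrite /= rmorph0 ?add0r ?addr0.
by rewrite !s !mulr1 subrKC.
Qed.

End Traces.

(** * Equivalence of the two gadgets *)

Section Equivalence.
Variable R : realType.

(** The strategy enters the trace probabilities only through [yield]: letters of [A] scale the total
    mass by [kappa], [sharp] extracts half of the yield and [dollar] half of the rest, after which
    all mass is in the sink. *)
Lemma Tr_eq c1 c2 (alpha1 alpha2 : lpath glabel gstate ->
      {ffun glabel * gstate -> rat} -> R) :
  is_strategy (gadget c1) alpha1 -> is_strategy (gadget c2) alpha2 ->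
  (forall u, yield c1 alpha1 (sharp :: letters u) =
             yield c2 alpha2 (sharp :: letters u)) ->
  Tr (gadget c1) alpha1 =1 Tr (gadget c2) alpha2.
Proof.
move=> s1 s2 ey w; rewrite !Tr_mass //.
(* All remaining mass, possibly none, is in the sink; the yield is then 0. *)
pose sunk w0 := forall x, mass (gadget c1) alpha1 w0 (Some (Some x)) = 0 /\
  mass (gadget c2) alpha2 w0 (Some (Some x)) = 0.
suff : w = [::] \/ [/\ mass (gadget c1) alpha1 w None = 0,
    mass (gadget c2) alpha2 w None = 0,
    \sum_x mass (gadget c1) alpha1 w (Some x) =
      \sum_x mass (gadget c2) alpha2 w (Some x) &
    (exists u, w = sharp :: letters u) \/ sunk w].
  case=> [->|[h1 h2 e _]]; first by apply: eq_bigr => q _; rewrite !mass_nil.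
  by rewrite big_option [RHS]big_option h1 h2 e.
elim/last_ind: w => [|w l [->|[h1 h2 e h]]]; first by left.
  right; split; try exact: mass_rcons_None.
    have [->|ne] := eqVneq l sharp; first by rewrite !total_start.
    by rewrite !big1 // => x _; rewrite mass_start_other.
  have [->|ne] := eqVneq l sharp; first by left; exists [::].
  by right=> x; rewrite !mass_start_other.
have eyw : yield c1 alpha1 w = yield c2 alpha2 w.
  case: h => [[u ->] //|sk]; have [z1 z2] := sk (acc, true).
  by rewrite /yield !flow_mass0 ?acc_true.
right; split; try exact: mass_rcons_None.
  case: l => [[a|]|].
  - by rewrite !(total_letter _ a) // e.
  - by rewrite !total_dollar // e eyw.
  - by rewrite !total_sharp // eyw.
case: l => [[a|]|]; [|by right=> x; rewrite !mass_dollar..|].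
- case: h => [[u ->]|sk]; [left|right].
    by exists (rcons u a); rewrite /letters map_rcons.
  move=> x; rewrite !(mass_letter _ a) // !big_option /= mul0r rmorph0 !mulr0 !add0r.
  by rewrite !big1 // => y _; have [z1 z2] := sk y; rewrite ?z1 ?z2 mul0r.
- by right=> x; rewrite !mass_sharp.
Qed.

Definition markov (b : bool) (theta : seq glabel -> R)
    (rho : lpath glabel gstate) (m : {ffun glabel * gstate -> rat}) : R :=
  if last_state rho is Some x then
    if Some x == acc_state then
      if m == step_move true (Some (acc, true)) then theta (trace rho)
      else 1 - theta (trace rho)
    else 1
  else (m == start_move b)%:R.

Lemma markov_strategy c b theta : (forall w, 0 <= theta w <= 1) -> b || c ->
  is_strategy (gadget c) (markov b theta).
Proof.
move=> th bc rho; rewrite /markov; have /andP[t0 t1] := th (trace rho).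
case: (last_state rho) => [x|] /=.
  split=> [m _|].
    by case: ifP => // _; case: ifP => // _; rewrite subr_ge0.
  rewrite /gmoves; case: ifP => [/eqP[->]|_]; last by rewrite big_seq1.
  rewrite !big_cons big_nil addr0.
  rewrite eqxx eq_sym (negPf (step_move_neq _)).
  by rewrite addrC subrK.
split=> [m _|]; first exact: ler0n.
rewrite /gmoves; have := start_move_neq; case: c b bc => [] [] // _ ne.
- by rewrite !big_cons big_nil !eqxx eq_sym (negPf ne) !addr0.
- by rewrite !big_cons big_nil !eqxx (negPf ne) add0r addr0.
- by rewrite big_seq1 eqxx.
Qed.

Lemma markov_yield c b theta w : is_strategy (gadget c) (markov b theta) ->
  yield c (markov b theta) w =
  theta w * mass (gadget c) (markov b theta) w acc_state.
Proof.
move=> st; by rewrite /yield (@flow_markov _ _ _ _ _ (fun w q m =>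
  if q is Some x then
    if Some x == acc_state then
      if m == step_move true (Some (acc, true)) then theta w else 1 - theta w
    else 1
  else (m == start_move b)%:R)) //= !eqxx.
Qed.

Lemma markov_mix c b theta : is_strategy (gadget c) (markov b theta) ->
  mix c (markov b theta) = b%:R.
Proof.
move=> st; rewrite /mix (@flow_markov _ _ _ _ _ (fun w q m =>
  if q is Some x then
    if Some x == acc_state then
      if m == step_move true (Some (acc, true)) then theta w else 1 - theta w
    else 1
  else (m == start_move b)%:R)) // mass_nil // eqxx mulr1.
by case: b {st}; rewrite ?eqxx // (negPf start_move_neq).
Qed.

Lemma mix_false (alpha : lpath glabel gstate -> {ffun glabel * gstate -> rat} -> R) :
  is_strategy (gadget false) alpha -> mix false alpha = 1.
Proof.
by move=> st; have := sum_flow st [::] None; rewrite mass_nil //= /gmoves big_seq1.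
Qed.

Definition vacc b u : rat := vmass b u (Some (acc, true)).

(** Starting with [start_move true] and playing [sharp] with the right probability realizes any
    yield between 0 and [vacc true u]. The yield of [alpha] lies there, being at most a mixture of
    [vacc true u] and [vacc false u]. *)
Lemma refines_gadget c1 c2 : (forall u, vacc false u <= vacc true u) ->
  refines R (gadget c1) (gadget c2).
Proof.
move=> le alpha st.
pose full := markov true (fun=> 1).
have stf : is_strategy (gadget c2) full.
  by apply: markov_strategy => // w; rewrite ler01 lexx.
pose top w := mass (gadget c2) full w acc_state.
have topE u : top (sharp :: letters u) = ratr (vacc true u).
  by rewrite /top mass_letters // markov_mix // subrr mul0r addr0 mul1r.
(* The test makes [theta] a probability on all words, even those not of the form
   [sharp :: letters u]; where [top] is 0 the quotient is 0 by convention. *)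
pose theta w := if yield c1 alpha w <= top w then yield c1 alpha w / top w else 0.
have top0 w : 0 <= top w by exact: mass_ge0.
have th w : 0 <= theta w <= 1.
  rewrite /theta; case: ifP => [le1|_]; last by rewrite lexx ler01.
  rewrite divr_ge0 ?yield_ge0 //=.
  have [z|nz] := eqVneq (top w) 0; first by rewrite z invr0 mulr0 ler01.
  by rewrite ler_pdivrMr ?mul1r // lt_def nz top0.
have st2 : is_strategy (gadget c2) (markov true theta) by exact: markov_strategy.
exists (markov true theta) => //; apply: Tr_eq => // u.
rewrite markov_yield // mass_letters // markov_mix // subrr mul0r addr0 mul1r -topE.
have yt : yield c1 alpha (sharp :: letters u) <= top (sharp :: letters u).
  apply: le_trans (yield_le st _) _; rewrite mass_letters // topE.
  have := mix_ge0 st; have := mix_le1 st; set l := mix _ _ => l1 l0.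
  have vv : ratr (vacc false u) <= ratr (vacc true u) :> R by rewrite ler_rat.
  rewrite -subr_ge0 -/(vacc true u) -/(vacc false u).
  move: vv l0 l1; move: (ratr _) (ratr _) l => q p l pq l0 l1.
  have -> : q - (l * q + (1 - l) * p) = (1 - l) * (q - p) by ring.
  by rewrite mulr_ge0 // subr_ge0.
rewrite /theta yt; have [z|nz] := eqVneq (top (sharp :: letters u)) 0.
  by rewrite z mulr0; apply/eqP; rewrite eq_le yield_ge0 // andbT -z.
by rewrite divfK.
Qed.

Lemma gadgetP :
  refines R (gadget true) (gadget false) /\ refines R (gadget false) (gadget true)
  <-> forall u, vacc false u <= vacc true u.
Proof.
split=> [[ref _] u|le]; last by split; apply: refines_gadget.
(* Exchanging the signs first and always playing [sharp] yields [vacc false u], whereas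
   [gadget false] yields at most [vacc true u]. *)
have st : is_strategy (gadget true) (markov false (fun=> 1)).
  by apply: markov_strategy => // w; rewrite ler01 lexx.
have [beta stb e] := ref _ st.
have := e (rcons (sharp :: letters u) sharp); rewrite !yield_Tr //.
move=> /(congr1 ( *%R^~ 2)); rewrite !divfK ?pnatr_eq0 // markov_yield // mul1r.
rewrite mass_letters // markov_mix // mul0r add0r subr0 mul1r => ey.
have := yield_le stb (sharp :: letters u).
by rewrite -ey mass_letters // mix_false // mul1r subrr mul0r addr0 ler_rat.
Qed.

End Equivalence.

(** * Comparison with the values of the weighted automaton *)

Definition wvec (u : seq A) : T -> rat :=
  foldl (fun v a t' => \sum_t v t * (W a t t')%:~R) v0 u.

(** [move_weight] only tests whether two signs agree, so flipping the signs of source and target is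
    a symmetry. *)
Lemma vmass_swap u t b : vmass false u (Some (t, b)) = vmass true u (Some (t, ~~ b)).
Proof.
elim/last_ind: u t b => [|u a ih] t b; first by rewrite /vmass /=; case: b.
rewrite !vmass_rcons /vstep !big_option /= !(mul0r, mulr0, add0r).
rewrite !big_pairE; apply: eq_bigr => t' _; rewrite !big_bool /= !ih addrC.
by rewrite /move_weight /=; case: b.
Qed.

(** The difference of the two copies evolves by the positive part minus the negative part, which is
    the weight itself; each letter adds the normalization [kappa / scale]. *)
Lemma vmass_diff u t : vmass true u (Some (t, true)) - vmass true u (Some (t, false)) =
  wvec u t * (kappa / scale%:R) ^+ size u.
Proof.
elim/last_ind: u t => [|u a ih] t.
  by rewrite /vmass /wvec /= mulr1n mulr0n subr0 mulr1.
rewrite /wvec foldl_rcons -/(wvec u) !vmass_rcons /vstep !big_option /=.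
rewrite !(mul0r, mulr0, add0r) !big_pairE -sumrB mulr_suml.
apply: eq_bigr => t' _; rewrite !big_bool /= size_rcons exprS.
have pw : (part true (W a t' t))%:R - (part false (W a t' t))%:R = (W a t' t)%:~R :> rat.
  by rewrite -[in RHS](part_sub (W a t' t)) rmorphB.
rewrite /move_weight /= -pw; have := ih t'.
move: (vmass _ _ _) (vmass _ _ _) => p q e.
have -> : wvec u t' * ((part true (W a t' t))%:R - (part false (W a t' t))%:R) *
    (kappa / scale%:R * (kappa / scale%:R) ^+ size u) =
  wvec u t' * (kappa / scale%:R) ^+ size u *
  ((part true (W a t' t))%:R - (part false (W a t' t))%:R) * (kappa / scale%:R) by ring.
by rewrite -e; ring.
Qed.

Lemma gadget_equiv (R : realType) :
  refines R (gadget true) (gadget false) /\ refines R (gadget false) (gadget true)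
  <-> forall u, 0 <= wvec u acc.
Proof.
have key u : (vacc false u <= vacc true u) = (0 <= wvec u acc).
  rewrite /vacc vmass_swap /= -subr_ge0 vmass_diff pmulr_lge0 //.
  by rewrite exprn_gt0 // divr_gt0 ?kappa_gt0 ?scale_gt0.
by rewrite gadgetP; split=> h u; have := h u; rewrite key.
Qed.

End Gadget.

(** * The weighted automaton of a flow graph *)

Section Weights.
Variables (E : seq edge) (h : nat).

(** Exceeds every coordinate in use: register [r] is coordinate [r.+2], and the input is coordinate
    3. *)
Definition bound : nat := (\sum_(e <- E) (e.1.2.1.1.2 + e.1.2.1.2))%N.+4.

Lemma bound_edge e : e \in E -> (e.1.2.1.1.2.+2 < bound)%N && (e.1.2.1.2.+2 < bound)%N.
Proof.
move=> eE; rewrite /bound (big_rem e eE) /=.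
set s := (\sum_(_ <- _) _)%N.
move: (e.1.2.1.1.2) (e.1.2.1.2) s => r t s; lia.
Qed.

Definition bounded (l : form) : bool := all (fun p => p.1 < bound)%N l.

Lemma bounded_update (a : letter E) j : (j < bound)%N -> bounded (update a j).
Proof.
case: a => [i|] //= jb; have := bound_edge (mem_tnth i (in_tuple E)).
rewrite -/(edge_of i); case: (edge_of i) => [[p [[[b r] t] d]] q] /= /andP[rb tb].
by case: ifP => _ //; case: ifP => _; rewrite /bounded /= ?jb ?tb.
Qed.

Lemma bounded_guard_test (a : letter E) : bounded (guard_test a).
Proof.
case: a => [i|] //=; have := bound_edge (mem_tnth i (in_tuple E)).
rewrite -/(edge_of i); case: (edge_of i) => [[p [[[b r] t] d]] q] /= /andP[rb tb].
by case: b; rewrite /bounded /= ?rb ?tb.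
Qed.

(* None accumulates the cost; (i, j) carries the product of the coordinates i
   and j of the configuration. *)
Definition cell : finType := option ('I_bound * 'I_bound).

(** Coefficient of [x i * x j] in the quadratic form [cost h a x]. *)
Definition cost_coef (a : letter E) (i j : nat) : int :=
  fcoef (guard_pc h a) i * fcoef (guard_pc h a) j +
  fcoef (guard_test a) i * fcoef (guard_test a) j -
  (i == 0%N)%:R * (j == 0%N)%:R *+ (a == None).

Definition cell_weight (a : letter E) (u v : cell) : int :=
  match u, v with
  | None, None => 1
  | None, Some _ => 0
  | Some (i, j), None => cost_coef a i j
  | Some (i, j), Some (i', j') => fcoef (update a i') i * fcoef (update a j') j
  end.

(* The inputs (b1, b2) duplicate the cells whose initial weight depends on the
   input register, which is coordinate 3. *)
Definition node : finType := ((bool * bool) + cell)%type.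

Definition input_coord (b : bool) : 'I_bound := inord (if b then 3 else 0).

Definition cell_of (t : node) : cell :=
  match t with
  | inl (b1, b2) => Some (input_coord b1, input_coord b2)
  | inr u => u
  end.

Definition weight (a : letter E) (t t' : node) : int :=
  if t' is inr v then cell_weight a (cell_of t) v else 0.

(** The nonzero initial coordinates are 1 and [c]; their products sum to [(c + 1) ^ 2], which
    normalizes the tensor square to a distribution. *)
Definition init_prob (c : nat) (t : node) : rat :=
  match t with
  | inl (b1, b2) => (c ^ (b1 + b2))%N%:R / (c.+1 ^ 2)%N%:R
  | inr _ => 0
  end.

Definition init_weight (c : nat) : {ffun node -> rat} := [ffun t => init_prob c t].

Lemma big_sum (V : nmodType) (S T : finType) (F : S + T -> V) :
  \sum_t F t = \sum_x F (inl x) + \sum_y F (inr y).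
Proof. by rewrite big_sumType. Qed.

Lemma init_weight_dist c : is_dist (init_weight c).
Proof.
apply/andP; split.
  by apply/forallP => -[[b1 b2]|u]; rewrite ffunE // divr_ge0 ?ler0n.
rewrite big_sum [X in _ + X]big1 ?addr0 => [|u _]; last by rewrite ffunE.
rewrite big_pairE !big_bool !ffunE /= -!mulrDl -!natrD.
rewrite (_ : (_ + _)%N = c.+1 ^ 2)%N ?divff // ?pnatr_eq0 ?expn_eq0 //.
by rewrite !expnS !expn0; lia.
Qed.

(* The vector v represents the configuration x and the cost e, up to a scalar. *)
Definition represents (z : rat) (v : node -> rat) (x : nat -> int) (e : int) : Prop :=
  forall F : cell -> rat, \sum_t v t * F (cell_of t) =
  z * (\sum_(i < bound) \sum_(j < bound) (x i)%:~R * (x j)%:~R * F (Some (i, j))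
       + e%:~R * F None).

Lemma represents_acc z v x e : represents z v x e ->
  v (inr None) = z * e%:~R.
Proof.
move=> /(_ (fun u => (u == None)%:R)); rewrite big_sum [X in X + _]big1 ?add0r; last first.
  by move=> [b1 b2] _; rewrite mulr0.
rewrite big_option [X in _ + X]big1 ?addr0 => [|p _]; last by rewrite mulr0.
rewrite eqxx !mulr1 => ->; rewrite big1 ?add0r // => i _.
by rewrite big1 // => j _; rewrite mulr0.
Qed.

Lemma represents_init c :
  represents (c.+1 ^ 2)%N%:R^-1 (init_weight c) (config 0 (input c)) 0.
Proof.
move=> F; rewrite mul0r addr0 big_sum [X in _ + X]big1 ?addr0 => [|u _]; last first.
  by rewrite ffunE mul0r.
have coordE b : (input_coord b : nat) = if b then 3 else 0%N.
  by rewrite inordK //; case: b; rewrite /bound; lia.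
(* Initially only the coordinates 0 (the constant) and 3 (the input) may be nonzero. *)
have supp (G : 'I_bound -> rat) :
    \sum_(i < bound) (config 0 (input c) i)%:~R * G i =
    \sum_(b : bool) (c ^ b)%N%:R * G (input_coord b).
  rewrite big_bool (bigD1 (input_coord true)) //= (bigD1 (input_coord false)) /=; last first.
    by rewrite -val_eqE /= !coordE.
  rewrite !coordE /= big1 ?addr0 => [|i /andP[]]; last first.
    rewrite -!val_eqE /= !coordE; case: (val i) => [|[|[|[|k]]]] //= _ _; rewrite ?mul0r //.
    by rewrite /input; case: eqP => // -[].
under [in RHS]eq_bigr do under eq_bigr do rewrite -mulrA.
under [in RHS]eq_bigr do rewrite -mulr_sumr supp.
rewrite supp mulr_sumr big_pairE; apply: eq_bigr => b1 _.
rewrite !mulr_sumr; apply: eq_bigr => b2 _; rewrite ffunE /= expnD natrM.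
by ring.
Qed.

Lemma represents_step z v x e a : represents z v x e ->
  represents z (fun t' => \sum_t v t * (weight a t t')%:~R)
    (next a x) (e + cost h a x).
Proof.
move=> rep F; rewrite big_sum [X in X + _]big1 ?add0r => [|b _]; last first.
  by rewrite big1 ?mul0r // => t _; rewrite mulr0.
(* The hypothesis is applied to each column of [cell_weight a]. *)
under eq_bigr do rewrite /= (rep (fun u => (cell_weight a u _)%:~R)) -mulrA.
rewrite -mulr_sumr big_option /=; congr (_ * _).
have fv l : bounded l -> (fval l x)%:~R =
    \sum_(i < bound) (x i)%:~R * (fcoef l i)%:~R :> rat.
  by move=> bl; rewrite -(fvalE x bl) rmorph_sum; apply: eq_bigr => i _; rewrite rmorphM.
have prod (f g : 'I_bound -> rat) : \sum_(i < bound) \sum_(j < bound)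
    (x i)%:~R * (x j)%:~R * (f i * g j) =
    (\sum_(i < bound) (x i)%:~R * f i) * (\sum_(i < bound) (x i)%:~R * g i).
  rewrite mulr_suml; apply: eq_bigr => i _; rewrite mulr_sumr.
  by apply: eq_bigr => j _; ring.
rewrite addrC; congr (_ + _).
  rewrite big_pairE; apply: eq_bigr => i' _; apply: eq_bigr => j' _.
  rewrite mulr0 addr0 /next !fv ?bounded_update // -prod; congr (_ * _).
  by apply: eq_bigr => i _; apply: eq_bigr => j _; rewrite rmorphM.
rewrite mulr1 addrC rmorphD; congr ((_ + _) * _).
rewrite /cost rmorphB rmorphD /= !rmorphXn /= !expr2.
rewrite (fv (guard_pc h a)) // (fv (guard_test a)) ?bounded_guard_test //.
have x0 : (x 0%N)%:~R = \sum_(i < bound) (x i)%:~R * (nat_of_ord i == 0%N)%:R :> rat.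
  rewrite (bigD1 ord0) //= mulr1 big1 ?addr0 // => i.
  by rewrite -val_eqE /= => /negPf ->; rewrite mulr0.
rewrite rmorphMn /= rmorphM /= x0 -!prod -sumrMnl -big_split -sumrB /=.
apply: eq_bigr => i _; rewrite -sumrMnl -big_split -sumrB /=.
apply: eq_bigr => j _; rewrite /cost_coef rmorphB rmorphD !rmorphM /=.
rewrite rmorphMn rmorphM /= !rmorph_nat.
case: (a == None); ring.
Qed.

Lemma wvec_total c w :
  wvec weight (init_weight c) w (inr None) =
  (c.+1 ^ 2)%N%:R^-1 * (total h (config 0 (input c)) w)%:~R.
Proof.
suff rep : represents (c.+1 ^ 2)%N%:R^-1 (wvec weight (init_weight c) w)
    (foldl (fun y b => next b y) (config 0 (input c)) w)
    (total h (config 0 (input c)) w).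
  exact: represents_acc rep.
elim/last_ind: w => [|w a ih]; first exact: represents_init.
rewrite /wvec !foldl_rcons total_rcons; exact: represents_step.
Qed.

Definition machine_mdp (c : nat) (b : bool) :=
  gadget weight (inr None) None (init_weight_dist c) b.

Lemma machine_mdpP (R : realType) c :
  (refines R (machine_mdp c true) (machine_mdp c false) /\
   refines R (machine_mdp c false) (machine_mdp c true)) <->
  ~ exists s', flat E 0 (input c) h s'.
Proof.
rewrite gadget_equiv -totalP.
have pos : 0 < (c.+1 ^ 2)%N%:R^-1 :> rat by rewrite invr_gt0 ltr0n expn_gt0.
split=> [H [w lt0]|H w].
  by have := H w; rewrite wvec_total pmulr_rge0 // ler0z leNgt lt0.
rewrite wvec_total pmulr_rge0 // ler0z leNgt; apply/negP => lt0.
by apply: H; exists w.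
Qed.
End Weights.

(** * Codes and diagonalization *)

Section Recursive.
Local Open Scope nat_scope.

Lemma eval_comp1 f g xs v y : eval g xs v -> eval f [:: v] y -> eval (Comp f [:: g]) xs y.
Proof. by move=> ev; apply: (@eval_comp _ _ _ [:: v]) => // -[]. Qed.

Lemma eval_comp2 f g1 g2 xs v1 v2 y : eval g1 xs v1 -> eval g2 xs v2 ->
  eval f [:: v1; v2] y -> eval (Comp f [:: g1; g2]) xs y.
Proof. by move=> e1 e2; apply: (@eval_comp _ _ _ [:: v1; v2]) => // -[|[]]. Qed.

Lemma eval_proj_nth i xs y : i < size xs -> nth 0 xs i = y -> eval (Proj i) xs y.
Proof. by move=> lti <-; exact: eval_proj. Qed.

Definition rec_double : recf := Prec Zero (Comp Succ [:: Comp Succ [:: Proj 1]]).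

Lemma eval_double n : eval rec_double [:: n] n.*2.
Proof.
elim: n => [|n ih]; first exact/eval_prec0/eval_zero.
apply: eval_precS ih _; apply: eval_comp1 (eval_succ _).
by apply: eval_comp1 (eval_succ _); apply: eval_proj_nth.
Qed.

Definition rec_add : recf := Prec (Proj 0) (Comp Succ [:: Proj 1]).

Lemma eval_add m n : eval rec_add [:: m; n] (m + n).
Proof.
elim: m => [|m ih]; first by apply: eval_prec0; apply: eval_proj_nth.
apply: eval_precS ih _; apply: eval_comp1 (eval_succ _).
exact: eval_proj_nth.
Qed.

Definition rec_mul : recf := Prec Zero (Comp rec_add [:: Proj 2; Proj 1]).

Lemma eval_mul m n : eval rec_mul [:: m; n] (m * n).
Proof.
elim: m => [|m ih]; first exact/eval_prec0/eval_zero.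
apply: eval_precS ih _; rewrite mulSn.
by apply: eval_comp2 (eval_add _ _); apply: eval_proj_nth.
Qed.

Definition consn (n m : nat) : nat := 2 ^ n * m.*2.+1.

Lemma code_cons n s : CodeSeq.code (n :: s) = consn n (CodeSeq.code s).
Proof. by []. Qed.

Definition rec_cons : recf :=
  Prec (Comp Succ [:: rec_double]) (Comp rec_double [:: Proj 1]).

Lemma eval_cons n m : eval rec_cons [:: n; m] (consn n m).
Proof.
elim: n => [|n ih].
  rewrite /consn expn0 mul1n; apply: eval_prec0.
  exact: eval_comp1 (eval_double _) (eval_succ _).
apply: eval_precS ih _; rewrite /consn expnS -mulnA mul2n.
by apply: eval_comp1 (eval_double _); apply: eval_proj_nth.
Qed.

Definition rec_is_zero : recf := Prec (Comp Succ [:: Zero]) Zero.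

Lemma eval_is_zero n : eval rec_is_zero [:: n] (n == 0).
Proof.
elim: n => [|n ih].
  by apply: eval_prec0; apply: eval_comp1 (eval_zero _) (eval_succ _).
by apply: eval_precS ih (eval_zero _).
Qed.

(** Terms in which the codes of the gadgets are written; one translation makes all of them
    recursive. *)
Inductive expr :=
| EVar of nat
| EZero
| ESucc of expr
| EMul of expr & expr
| ECons of expr & expr.

Fixpoint value (xs : seq nat) (e : expr) : nat :=
  match e with
  | EVar i => nth 0 xs i
  | EZero => 0
  | ESucc e => (value xs e).+1
  | EMul e1 e2 => value xs e1 * value xs e2
  | ECons e1 e2 => consn (value xs e1) (value xs e2)
  end.

Fixpoint closed n (e : expr) : bool :=
  match e with
  | EVar i => i < n
  | EZero => true
  | ESucc e => closed n e
  | EMul e1 e2 | ECons e1 e2 => closed n e1 && closed n e2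
  end.

Fixpoint rec_expr (e : expr) : recf :=
  match e with
  | EVar i => Proj i
  | EZero => Zero
  | ESucc e => Comp Succ [:: rec_expr e]
  | EMul e1 e2 => Comp rec_mul [:: rec_expr e1; rec_expr e2]
  | ECons e1 e2 => Comp rec_cons [:: rec_expr e1; rec_expr e2]
  end.

Lemma eval_expr xs e : closed (size xs) e -> eval (rec_expr e) xs (value xs e).
Proof.
elim: e => [i||e ih|e1 ih1 e2 ih2|e1 ih1 e2 ih2] /=.
- exact: eval_proj.
- by move=> _; exact: eval_zero.
- by move=> /ih ev; apply: eval_comp1 ev (eval_succ _).
- by move=> /andP[/ih1 ev1 /ih2 ev2]; apply: eval_comp2 ev1 ev2 (eval_mul _ _).
- by move=> /andP[/ih1 ev1 /ih2 ev2]; apply: eval_comp2 ev1 ev2 (eval_cons _ _).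
Qed.

Definition elist (es : seq expr) (e : expr) : expr := foldr ECons e es.

Lemma value_elist xs es e s : value xs e = CodeSeq.code s ->
  value xs (elist es e) = CodeSeq.code (map (value xs) es ++ s).
Proof. by move=> ev; elim: es => //= e' es ->. Qed.

(* The codes of the two gadgets as functions of five numbers, at the positions
   o, ..., o + 4 of the environment: the numbers of states and labels, the code of
   the initial distribution, the code of the moves of the noninitial states, and
   the code of the null entries at the end of the initial moves. *)
Definition input_expr (o : nat) : expr := elist [seq EVar (o + i) | i <- iota 0 5] EZero.
Definition one_expr : expr := ESucc EZero.
Definition zero_rat_expr : expr := elist [:: EZero; one_expr] EZero.
(** Code of the fraction of [e] by [(c + 1) ^ 2], where [c] is the code of the five numbers; it is
    in lowest terms when [e] is a power of [c]. *)
Definition ratio_expr (o : nat) (e : expr) : expr :=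
  elist [:: e; EMul (ESucc (input_expr o)) (ESucc (input_expr o))] EZero.
(** Entries for the letter [sharp]: initial state, sink, then the inputs from [(true, true)] to
    [(false, false)], each with sign [true] before [false]. The null entries follow. *)
Definition start_expr (o : nat) (b : bool) : expr :=
  let z := zero_rat_expr in
  let r0 := ratio_expr o one_expr in
  let r1 := ratio_expr o (input_expr o) in
  let r2 := ratio_expr o (EMul (input_expr o) (input_expr o)) in
  elist (if b then [:: z; z; r2; z; r1; z; r1; z; r0; z]
         else [:: z; z; z; r2; z; r1; z; r1; z; r0]) (EVar (o + 4)).
Definition mdp_expr (o : nat) (b : bool) : expr :=
  elist [:: EVar o; EVar (o + 1); EVar (o + 2);
    ECons (elist (if b then [:: start_expr o true; start_expr o false]
                  else [:: start_expr o true]) EZero) (EVar (o + 3))] EZero.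
End Recursive.

(** * Codes of the gadgets of a flow graph *)

Lemma code_rat_frac n d : coprime n d -> (0 < d)%N ->
  code_rat (n%:R / d%:R) = CodeSeq.code [:: n; d].
Proof.
move=> cop d0; rewrite /code_rat -[n%:R]/(n%:Z%:~R) -[d%:R]/(d%:Z%:~R).
rewrite coprimeq_num // coprimeq_den //= eqz_nat gtn_eqF //.
by rewrite gtr0_sg ?ltz_nat // mul1r ger0_norm // !absz_nat.
Qed.

Lemma enum_option (T : finType) : enum {: option T} = None :: map some (enum T).
Proof. by rewrite !enumT [in LHS]unlock. Qed.

Lemma enum_sum (S T : finType) : enum {: S + T} = map inl (enum S) ++ map inr (enum T).
Proof. by rewrite !enumT [in LHS]unlock. Qed.

Lemma enum_prod (S T : finType) : enum {: S * T} = [seq (x, y) | x <- enum S, y <- enum T].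
Proof. by rewrite [LHS]enumT [in LHS]unlock. Qed.

Lemma enum_bool : enum {: bool} = [:: true; false].
Proof. by rewrite enumT unlock. Qed.

Section GadgetCodes.
Variables (E : seq edge) (h : nat).

Definition zero_code : nat := code_rat 0.

Definition init_code : nat :=
  CodeSeq.code [seq code_rat (ginit (node E) q) | q <- enum (gstate (node E))].

(** The values 0 and [true] are arbitrary: the moves of a noninitial state are the same for all
    inputs and in both gadgets. *)
Definition moves_code : nat :=
  CodeSeq.code [seq CodeSeq.code [seq
      CodeSeq.code [seq code_rat (m (a, q')) | a <- enum (glabel (letter E)),
                                               q' <- enum (gstate (node E))]
    | m : {ffun glabel (letter E) * gstate (node E) -> rat}
      <- gmoves (weight (E := E) h) (inr None) (init_weight E 0) true (Some x)]
  | x <- enum {: option (node E * bool)}].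

Definition null_entries : seq nat :=
  [seq zero_code | _ <- enum (cell E), _ <- enum {: bool}] ++
  [seq zero_code | _ <- enum {: option (letter E)}, _ <- enum (gstate (node E))].

Definition params : seq nat :=
  [:: #|gstate (node E)|; #|glabel (letter E)|; init_code; moves_code;
      CodeSeq.code null_entries].

Lemma start_entries c b :
  [seq code_rat (start_move (letter E) (init_weight E c) b (a, q')) |
    a <- enum (glabel (letter E)), q' <- enum (gstate (node E))] =
  let z := zero_code in
  let r k := CodeSeq.code [:: c ^ k; c.+1 ^ 2]%N in
  (if b then [:: z; z; r 2; z; r 1; z; r 1; z; r 0; z]%N
   else [:: z; z; z; r 2; z; r 1; z; r 1; z; r 0]%N) ++ null_entries.
Proof.
have rE k : code_rat ((c ^ k)%N%:R / (c.+1 ^ 2)%N%:R) = CodeSeq.code [:: c ^ k; c.+1 ^ 2]%N.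
  by rewrite code_rat_frac ?expn_gt0 // coprimeXl // coprimeXr // coprimenS.
have row0 : [seq code_rat (start_move (letter E) (init_weight E c) b (None, q')) |
    q' <- enum (gstate (node E))] =
    (let z := zero_code in
     let r k := CodeSeq.code [:: c ^ k; c.+1 ^ 2]%N in
     if b then [:: z; z; r 2; z; r 1; z; r 1; z; r 0; z]%N
     else [:: z; z; z; r 2; z; r 1; z; r 1; z; r 0]%N) ++
    [seq zero_code | _ <- enum (cell E), _ <- enum {: bool}].
  have sE t b' : start_move (letter E) (init_weight E c) b (None, Some (Some (t, b'))) =
      init_prob (E := E) c t *+ (b' == b) by rewrite !ffunE.
  have s0 : start_move (letter E) (init_weight E c) b (None, Some None) = 0.
    by rewrite ffunE.
  have s1 : start_move (letter E) (init_weight E c) b (None, None) = 0 by rewrite ffunE.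
  rewrite 2!enum_option enum_prod enum_sum enum_prod enum_bool /= !sE s0 s1.
  set tail := [seq _ | q' <- _].
  have -> : tail = [seq zero_code | _ <- enum (cell E), _ <- [:: true; false]].
    rewrite /tail; elim: (enum (cell E)) => //= u s ->; rewrite !sE.
    by rewrite !mul0rn.
  have r0E : code_rat (1 / (c.+1 ^ 2)%N%:R) = CodeSeq.code [:: c ^ 0; c.+1 ^ 2]%N := rE 0%N.
  by rewrite -/zero_code; case: b {s0 s1 sE tail};
     rewrite /= ?mulr0n ?mulr1n (rE 2) (rE 1%N) r0E.
rewrite (enum_option (option (letter E))) /= row0 -catA; congr (_ ++ (_ ++ _)).
elim: (enum {: option (letter E)}) => //= l s ->; congr (_ ++ _).
by apply: eq_map => q; rewrite ffunE.
Qed.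

(** When the input is the code of the parameters, [input_expr] recovers it from them, so that the
    parameters alone determine both codes. *)
Lemma code_machine c b : c = CodeSeq.code params ->
  code_mdp (machine_mdp E h c b) = value params (mdp_expr 0 b).
Proof.
move=> ec.
have vi : value params (input_expr 0) = c by rewrite ec.
have vz : value params zero_rat_expr = zero_code by [].
have vr e : value params (ratio_expr 0 e) = CodeSeq.code [:: value params e; c.+1 ^ 2]%N.
  by rewrite -mulnn -[X in X.+1]vi.
have v0 : value params one_expr = (c ^ 0)%N by [].
have v1 : value params (input_expr 0) = (c ^ 1)%N by [].
have v2 : value params (EMul (input_expr 0) (input_expr 0)) = (c ^ 2)%N.
  by rewrite -mulnn -vi.
have vs b' : value params (start_expr 0 b') = CodeSeq.code
    [seq code_rat (start_move (letter E) (init_weight E c) b' (a, q')) |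
      a <- enum (glabel (letter E)), q' <- enum (gstate (node E))].
  rewrite start_entries /start_expr.
  rewrite (@value_elist _ _ _ null_entries) //; congr (CodeSeq.code (_ ++ _)).
  by case: b'; rewrite !map_cons vz !vr v0 v1 v2.
rewrite /code_mdp (enum_option (option (node E * bool))) [in RHS]/mdp_expr.
have -> : value params (mdp_expr 0 b) = CodeSeq.code [:: #|gstate (node E)|;
    #|glabel (letter E)|; init_code; consn (value params
      (elist (if b then [:: start_expr 0 true; start_expr 0 false]
              else [:: start_expr 0 true]) EZero)) moves_code] by [].
rewrite (@value_elist _ _ _ [::]) // cats0.
have -> : [seq value params e | e <- if b then [:: start_expr 0 true; start_expr 0 false]
      else [:: start_expr 0 true]] =
    [seq CodeSeq.code [seq code_rat (m (a, q')) | a <- enum (glabel (letter E)),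
                                                  q' <- enum (gstate (node E))]
    | m : {ffun glabel (letter E) * gstate (node E) -> rat}
      <- gmoves (weight (E := E) h) (inr None) (init_weight E c) b None].
  by case: (b); rewrite !map_cons !vs.
rewrite /moves_code -code_cons; congr (CodeSeq.code [:: _; _; _; CodeSeq.code (_ :: _)]).
all: rewrite -(enum_option (option (node E * bool))) //.
by elim: (enum {: option (node E * bool)}) => //= x s ->.
Qed.

End GadgetCodes.

(** * Diagonalization against a decision procedure *)

Theorem theorem2 (R : realType) :
  undecidable (fun (L Q1 Q2 : finType) (D1 : mdp L Q1) (D2 : mdp L Q2) =>
    refines R D1 D2 /\ refines R D2 D1).
Proof.
case=> f dec.
(* [Mu] turns the answer into halting: [b] is defined iff [f] answers a nonzero value. The offset 1
   skips the search index that [Mu] puts in front. *)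
pose b := Mu (Comp rec_is_zero
  [:: Comp f [:: rec_expr (mdp_expr 1 true); rec_expr (mdp_expr 1 false)]]).
pose p := search 5 (rec_expr (input_expr 0)) b.
pose E := edges p 0; pose h := width p.
(* The parameters come from the graph of [p], which guesses them instead of containing them; this
   closes the self-reference. *)
pose xs := params E h; pose c := CodeSeq.code xs.
pose D := machine_mdp E h c.
have inputE ys : size ys = 5 -> eval (rec_expr (input_expr 0)) ys (CodeSeq.code ys).
  case: ys => [|y0 [|y1 [|y2 [|y3 [|y4 [|]]]]]] // _; exact: eval_expr.
have bodyE n v : eval f [:: code_mdp (D true); code_mdp (D false)] v ->
    eval (Comp rec_is_zero [:: Comp f
      [:: rec_expr (mdp_expr 1 true); rec_expr (mdp_expr 1 false)]]) (n :: xs) (v == 0%N).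
  rewrite !code_machine // => ev.
  apply: eval_comp1 (eval_is_zero v).
  by apply: eval_comp2 ev; apply: (@eval_expr (n :: xs)).
have [yes no] := dec _ _ _ (D true) (D false).
have := machine_mdpP E h R c; rewrite -/(D true) -/(D false) => equivP.
have runP : (exists s', flat E 0 (input c) h s') <->
    (exists ys, [/\ size ys = 5, eval (rec_expr (input_expr 0)) ys c &
      exists y, eval b ys y]) by exact: searchE.
(* If the two MDPs were equivalent, [f] would answer 1, so the program would halt after guessing
   [xs], contradicting equivalence. *)
have nP : ~ (refines R (D true) (D false) /\ refines R (D false) (D true)).
  move=> P; case: (equivP.1 P); apply/runP; exists xs; split=> //; first exact: inputE.
  exists 0%N; apply: (@eval_mu _ (fun=> 0%N)) => //.
  exact: (bodyE 0%N 1%N (yes P)).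
(* Conversely, a halting run must have guessed [xs], as codes are injective, but there [f] answers 0
   and [b] is undefined. *)
apply: (nP); apply/equivP => /runP[ys [sz ev [y evb]]].
have e : ys = xs.
  by apply: (can_inj CodeSeq.codeK); apply: eval_fun ev; apply: inputE.
inversion evb as [| | | | | |? ? ? ? _ zero]; subst.
by have := eval_fun (bodyE y 0%N (no nP)) zero.
Qed.
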